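(* Let $c_0$ be a sufficiently large constant. (a) If $c_0\leq r=r(n)=o(n^{1/4})$, there are constants $c_1,c_2>0$ such that with probability $1-o(1)$ as $n\to\infty$ the random regular graph $G_{n,r}$ satisfies $$c_1n/\sqrt r\leq\vartheta_{1/2}(G_{n,r})\leq\vartheta(G_{n,r})\leq\vartheta_2(G_{n,r})\leq c_2n/\sqrt r.$$ (b) There is a constant $c_3>0$ such that if $c_0\leq r=o(n^{1/2})$ then $$\Pr\big(c_3\sqrt r\leq\bar\vartheta_{1/2}(G_{n,r})\leq\bar\vartheta(G_{n,r})\leq\bar\vartheta_2(G_{n,r})\big)\geq 1-\exp(-n).$$
   Context: $G_{n,r}$ denotes an $r$-regular graph on $\{1,\dots,n\}$ chosen uniformly at random ($rn$ even). For a graph $G=(V,E)$ and a real $k>1$, an $n$-tuple $(v_1,\dots,v_n)$ of unit vectors in $\mathbb R^n$ is a vector $k$-coloring if $\langle v_i,v_j\rangle\leq-1/(k-1)$ for all $\{i,j\}\in E$; strict if $\langle v_i,v_j\rangle=-1/(k-1)$ for all $\{i,j\}\in E$; rigid if equality holds on all edges and $\langle v_i,v_j\rangle\geq-1/(k-1)$ for all non-adjacent $i\neq j$. $\bar\vartheta_{1/2}(G)$ (vector chromatic number), $\bar\vartheta(G)$, $\bar\vartheta_2(G)$ are the infima of $k>1$ such that $G$ admits a vector, strict vector, resp. rigid vector $k$-coloring; with $\bar G$ the complement, $\vartheta_{1/2}(G)=\bar\vartheta_{1/2}(\bar G)$, $\vartheta(G)=\bar\vartheta(\bar G)$ (Lovász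 number), $\vartheta_2(G)=\bar\vartheta_2(\bar G)$. *)

(* Defs.v *)
From HB Require Import structures.
From mathcomp Require Import all_boot all_order all_algebra.
From mathcomp Require Import all_classical all_reals all_analysis.
Set Implicit Arguments. Unset Strict Implicit. Unset Printing Implicit Defensive.
Import Order.TTheory GRing.Theory Num.Theory.
Local Open Scope ring_scope.
Local Open Scope classical_set_scope.

Section Defs.
Variable R : realType.

Definition dotv (n : nat) (u v : 'rV[R]_n) : R := (u *m v^T) 0 0.

Definition is_simple_graph (n : nat) (E : {set {set 'I_n}}) : bool :=
  [forall e, (e \in E) ==> (#|e| == 2)%N].

Definition is_regular_graph (n r : nat) (E : {set {set 'I_n}}) : bool :=
  is_simple_graph E && [forall i, #|[set e in E | i \in e]| == r].

Definition adj (n : nat) (E : {set {set 'I_n}}) : rel 'I_n :=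
  fun i j => (i != j) && ((i |: [set j])%SET \in E).

Definition compl_rel (n : nat) (g : rel 'I_n) : rel 'I_n :=
  fun i j => (i != j) && ~~ g i j.

Definition unit_family (n : nat) (v : 'I_n -> 'rV[R]_n) : Prop :=
  forall i, dotv (v i) (v i) = 1.

Definition vector_coloring (n : nat) (g : rel 'I_n) (k : R) : Prop :=
  exists v : 'I_n -> 'rV[R]_n, unit_family v /\
    (forall i j, g i j -> dotv (v i) (v j) <= - (k - 1)^-1).

Definition strict_vector_coloring (n : nat) (g : rel 'I_n) (k : R) : Prop :=
  exists v : 'I_n -> 'rV[R]_n, unit_family v /\
    (forall i j, g i j -> dotv (v i) (v j) = - (k - 1)^-1).

Definition rigid_vector_coloring (n : nat) (g : rel 'I_n) (k : R) : Prop :=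
  exists v : 'I_n -> 'rV[R]_n, unit_family v /\
    (forall i j, g i j -> dotv (v i) (v j) = - (k - 1)^-1) /\
    (forall i j, i != j -> ~~ g i j -> - (k - 1)^-1 <= dotv (v i) (v j)).

Definition thetabar_half (n : nat) (g : rel 'I_n) : R :=
  inf [set k : R | 1 < k /\ vector_coloring g k].
Definition thetabar (n : nat) (g : rel 'I_n) : R :=
  inf [set k : R | 1 < k /\ strict_vector_coloring g k].
Definition thetabar_2 (n : nat) (g : rel 'I_n) : R :=
  inf [set k : R | 1 < k /\ rigid_vector_coloring g k].

Definition theta_half (n : nat) (g : rel 'I_n) : R := thetabar_half (compl_rel g).
Definition theta (n : nat) (g : rel 'I_n) : R := thetabar (compl_rel g).
Definition theta_2 (n : nat) (g : rel 'I_n) : R := thetabar_2 (compl_rel g).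

(* Probability that the uniformly random r-regular graph G_{n,r} on 'I_n
   satisfies the property P (meaningful when r*n is even and r < n). *)
Definition prob_Gnr (n r : nat) (P : {set {set 'I_n}} -> Prop) : R :=
  (#|[set E : {set {set 'I_n}} | is_regular_graph r E && `[< P E >]]|%:R)
  / (#|[set E : {set {set 'I_n}} | is_regular_graph r E]|%:R).

End Defs.

Arguments thetabar_half {R n} g.
Arguments thetabar {R n} g.
Arguments thetabar_2 {R n} g.
Arguments theta_half {R n} g.
Arguments theta {R n} g.
Arguments theta_2 {R n} g.
Arguments prob_Gnr {R} n r P.

(* Main.v *)
Require Import Defs.
From HB Require Import structures.
From mathcomp Require Import all_boot all_order all_algebra.
From mathcomp Require Import all_classical all_reals all_analysis.
From mathcomp Require Import ring lra zify.
Set Implicit Arguments. Unset Strict Implicit. Unset Printing Implicit Defensive.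
Import Order.TTheory GRing.Theory Num.Theory.
Import numFieldNormedType.Exports.
Local Open Scope ring_scope.

(* Let A be the adjacency matrix of the random r-regular graph G and
   e(S, T) the number of pairs in S x T that are edges.  A switching replaces
   edges xy, uv by xv, uy; on average it drives e(S, T) towards r|S||T|/n, and
   comparing how many switchings leave and enter the graphs with
   e(S, T) >= t gives a Bernstein type tail directly in the uniform model of
   regular graphs.  A union bound over the sets of size at most n/16^t gives,
   outside an event of probability exp(-n/16^t), discrepancy
   O(sqrt r n / 32^t) as long as 16^t = O(sqrt r).

   With t = 0, Grothendieck's inequality turns this into the bound O(n sqrt r)
   for the form sum_ij (A_ij - r/n) <v_i, v_j> at unit vectors, and this yields
   the lower bounds for both vector chromatic numbers.

   For the upper bound on theta_2, semidefinite duality reduces the claim to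
   |sum_i w_i|^2 = O(n / sqrt r) sum_i |w_i|^2 for all vectors w_i with
   <w_i, w_j> <= 0 on the edges.  Normalise to sum_i |w_i|^2 = n and split
   the vertices by the size of |w_i|^2 in powers of 16: the discrepancy at level
   t bounds the sum over the level by a geometrically decreasing quantity, and
   the at most n / sqrt r vertices of largest norm are handled trivially. *)

(** A single cut bound does not reach theta_2: the dual vectors w_i may have very uneven norms, and
    Grothendieck's inequality then loses the ratio of max |w_i|^2 to its average. Hence the levels.
    By Markov, at most n / 16^t vertices have |w_i|^2 > 16^t. For two sets of that size the mean of
    e(S, T) is at most r n / 256^t and the entropy is of order (t + 1) n / 16^t, so the Gaussian
    part of the tail suggests a discrepancy sqrt(r (t + 1)) n / 64^t. Asking only for 32^t leaves a
    factor 2^t to absorb t and the linear part of the Bernstein exponent, and still beats the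
    squared norms 16^(t+1) geometrically. The levels may stop at 16^t ~ sqrt r because
    Cauchy-Schwarz bounds the squared sum over n / sqrt r vertices by n^2 / sqrt r, already the
    target. *)

(** * A truncation proof of Grothendieck's inequality *)

Section Rademacher.
Variables (R : realType) (I : finType).
Implicit Types (u v : I -> R) (e : {ffun I -> bool}) (l : seq I).

(** Random signs take the place of Gaussian variables, so that every expectation is a finite
    average. *)
Definition sgnv e i : R := (-1) ^+ e i.

Definition rsum l u e : R := \sum_(i <- l) sgnv e i * u i.

Definition flip (i : I) e : {ffun I -> bool} :=
  [ffun j => if j == i then ~~ e j else e j].

Lemma flipK i : involutive (flip i).
Proof.
by move=> e; apply/ffunP => j; rewrite !ffunE; case: eqP => // _; rewrite negbK.
Qed.

Lemma sgnv_flip i e : sgnv (flip i e) i = - sgnv e i.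
Proof. by rewrite /sgnv ffunE eqxx; case: (e i); rewrite /= ?expr1 ?expr0 ?opprK. Qed.

Lemma sqr_sgnv e i : sgnv e i * sgnv e i = 1.
Proof. by rewrite /sgnv -expr2 sqrr_sign. Qed.

Lemma rsum_flip i l u e : i \notin l -> rsum l u (flip i e) = rsum l u e.
Proof.
move=> il; apply: eq_big_seq => j jl; rewrite /sgnv ffunE.
by case: eqP => // ji; rewrite -ji jl in il.
Qed.

Lemma sum_sgnv_eq0 i (F : {ffun I -> bool} -> R) :
  (forall e, F (flip i e) = F e) -> \sum_e sgnv e i * F e = 0.
Proof.
move=> FE; set s := LHS.
suff : s = - s by lra.
rewrite /s [LHS](reindex_inj (inv_inj (flipK i))) -sumrN.
by apply: eq_bigr => e _; rewrite FE sgnv_flip mulNr.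
Qed.

Local Notation N := (#|{ffun I -> bool}|%:R : R).

Lemma sum_rsumM l u v : uniq l ->
  \sum_e rsum l u e * rsum l v e = N * \sum_(i <- l) u i * v i.
Proof.
elim: l => [|i l IH] /=.
  by move=> _; rewrite big_nil mulr0 big1 // => e _; rewrite /rsum big_nil mul0r.
case/andP=> il ul; rewrite big_cons mulrDr -IH //.
rewrite (eq_bigr (fun e => (u i * v i + rsum l u e * rsum l v e)
   + sgnv e i * (u i * rsum l v e + v i * rsum l u e))); last first.
  move=> e _; rewrite /rsum !big_cons -!/(rsum _ _ _).
  by have := sqr_sgnv e i; set s := sgnv e i; move=> ss; ring: ss.
rewrite big_split /= [X in _ + X]sum_sgnv_eq0 ?addr0; last first.
  by move=> e; rewrite !rsum_flip.
by rewrite big_split /= sumr_const -(mulr_natl (u i * v i)).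
Qed.

(** Khinchine's inequality for the fourth moment: one more coefficient [a] turns [3 N S^2] into
    [N (a^4 + 6 a^2 S + 3 S^2)], which is [3 N (a^2 + S)^2] minus [2 N a^4]. It controls what
    truncation cuts off. *)
Lemma sum_rsum4_le l u : uniq l ->
  \sum_e rsum l u e ^+ 4 <= 3 * N * (\sum_(i <- l) u i ^+ 2) ^+ 2.
Proof.
elim: l => [|i l IH] /=.
  by move=> _; rewrite big_nil expr0n mulr0 big1 // => e _; rewrite /rsum big_nil expr0n.
case/andP=> il ul; rewrite big_cons.
rewrite (eq_bigr (fun e => (u i ^+ 4 + rsum l u e ^+ 4
   + 6 * u i ^+ 2 * (rsum l u e * rsum l u e))
   + sgnv e i * (4 * u i ^+ 3 * rsum l u e + 4 * u i * rsum l u e ^+ 3))); last first.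
  move=> e _; rewrite /rsum !big_cons -!/(rsum _ _ _).
  by have := sqr_sgnv e i; set s := sgnv e i; move=> ss; ring: ss.
rewrite big_split /= [X in _ + X]sum_sgnv_eq0 ?addr0; last first.
  by move=> e; rewrite !rsum_flip.
rewrite !big_split /= sumr_const -(mulr_natl (u i ^+ 4)) -mulr_sumr sum_rsumM //.
have {IH} := IH ul; under [X in 6 * _ * (_ * X)]eq_bigr do rewrite -expr2.
set A := \sum_e _; set S := \sum_(i <- l) _; move=> IH.
have N0 : 0 <= N by rewrite ler0n.
have : 0 <= N * u i ^+ 4 by rewrite mulr_ge0 // exprn_even_ge0.
move: IH; set a := u i; set n := N; move=> IH H.
suff -> : 3 * n * (a ^+ 2 + S) ^+ 2 =
  (n * a ^+ 4 + 3 * n * S ^+ 2 + 6 * a ^+ 2 * (n * S)) + 2 * (n * a ^+ 4) by lra.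
by ring.
Qed.

End Rademacher.

(** Over the box the extreme value is the sum of the [|c i|], a difference of two subset sums. Used
    once per variable, this gives the 4 of [box_bound_cut]. *)
Lemma box_bound_linear (R : realType) (n : nat) (c x : 'I_n -> R) (D : R) :
  (forall S : {set 'I_n}, `|\sum_(i in S) c i| <= D) ->
  (forall i, `|x i| <= 1) -> `|\sum_i c i * x i| <= 2 * D.
Proof.
move=> hS hx; pose P := [set i | 0 <= c i].
have /ler_normlP[_ hP] := hS P; have /ler_normlP[hN _] := hS (~: P).
have hle : `|\sum_i c i * x i| <= \sum_i `|c i|.
  apply: le_trans (ler_norm_sum _ _ _) _; apply: ler_sum => i _.
  by rewrite normrM ler_piMr.
apply: le_trans hle _.
rewrite (bigID (mem P)) /= (_ : \sum_(i in P) _ = \sum_(i in P) c i); last first.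
  by apply: eq_bigr => i; rewrite inE => /ger0_norm.
rewrite (_ : \sum_(i | i \notin P) _ = - \sum_(i in ~: P) c i); first by lra.
rewrite -sumrN; apply: eq_big => i; rewrite !inE // -ltNge => /ltW.
exact: ler0_norm.
Qed.

Section Grothendieck.
Variables (R : realType) (m n : nat) (M : 'I_m -> 'I_n -> R).

Definition ipf (I : finType) (u v : I -> R) : R := \sum_i u i * v i.

(** All finite index types are allowed because [hilbert_bound_step] passes from vectors over [I] to
    vectors over the sign cube; a bound for one fixed [I] could not be iterated. *)
Definition hilbert_bound (c : R) := forall (I : finType)
  (u : 'I_m -> I -> R) (v : 'I_n -> I -> R),
  (forall i, ipf (u i) (u i) <= 1) -> (forall j, ipf (v j) (v j) <= 1) ->
  `|\sum_i \sum_j M i j * ipf (u i) (v j)| <= c.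

Definition box_bound (B : R) := forall (x : 'I_m -> R) (y : 'I_n -> R),
  (forall i, `|x i| <= 1) -> (forall j, `|y j| <= 1) ->
  `|\sum_i \sum_j M i j * (x i * y j)| <= B.


Lemma box_bound_cut (D : R) :
  (forall (S : {set 'I_m}) (T : {set 'I_n}),
     `|\sum_(i in S) \sum_(j in T) M i j| <= D) -> box_bound (4 * D).
Proof.
move=> hST x y hx hy.
have -> : \sum_i \sum_j M i j * (x i * y j) = \sum_i (\sum_j M i j * y j) * x i.
  by apply: eq_bigr => i _; rewrite mulr_suml; apply: eq_bigr => j _; ring.
rewrite (_ : 4 * D = 2 * (2 * D)); last by ring.
apply: box_bound_linear => // S.
rewrite exchange_big /=; under eq_bigr do rewrite -mulr_suml.
by apply: box_bound_linear => // T; rewrite exchange_big /=; apply: hST.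
Qed.

Lemma ipf_ge0 (I : finType) (u : I -> R) : 0 <= ipf u u.
Proof. by apply: sumr_ge0 => i _; rewrite -expr2 sqr_ge0. Qed.

Lemma ipfZ (I : finType) (a : R) (u v : I -> R) :
  ipf (fun i => a * u i) (fun i => a * v i) = a ^+ 2 * ipf u v.
Proof. by rewrite /ipf mulr_sumr; apply: eq_bigr => i _; ring. Qed.

Lemma ipf_le1 (I : finType) (u v : I -> R) :
  ipf u u <= 1 -> ipf v v <= 1 -> `|ipf u v| <= 1.
Proof.
move=> u1 v1.
have H1 : 0 <= ipf u u - 2 * ipf u v + ipf v v.
  have := ipf_ge0 (fun i => u i - v i); congr (_ <= _).
  by rewrite /ipf mulr_sumr -sumrB -big_split; apply: eq_bigr => i _ /=; ring.
have H2 : 0 <= ipf u u + 2 * ipf u v + ipf v v.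
  have := ipf_ge0 (fun i => u i + v i); congr (_ <= _).
  by rewrite /ipf mulr_sumr -!big_split; apply: eq_bigr => i _ /=; ring.
rewrite ler_norml; lra.
Qed.

Lemma hilbert_bound_trivial : hilbert_bound (\sum_i \sum_j `|M i j|).
Proof.
move=> I u v u1 v1; apply: le_trans (ler_norm_sum _ _ _) _.
apply: ler_sum => i _; apply: le_trans (ler_norm_sum _ _ _) _.
apply: ler_sum => j _; rewrite normrM ler_piMr //.
exact: ipf_le1.
Qed.

Definition trunc (z : R) : R := Num.max (- 2) (Num.min z 2).

Variant trunc_spec z : R -> Prop :=
| TruncMid of - 2 <= z <= 2 : trunc_spec z z
| TruncBig of 2 <= z : trunc_spec z 2
| TruncSmall of z <= - 2 : trunc_spec z (- 2).

Lemma truncP z : trunc_spec z (trunc z).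
Proof.
rewrite /trunc; case: (leP 2 z) => h2.
  by rewrite max_r; [exact: TruncBig | lra].
by case: (leP z (- 2)) => h; [exact: TruncSmall | apply: TruncMid; lra].
Qed.

Lemma trunc_le2 z : `|trunc z| <= 2.
Proof.
by rewrite ler_norml; case: (truncP z) => [|?|?] *; lra.
Qed.

Lemma sqr_trunc_le z : trunc z ^+ 2 <= z ^+ 2.
Proof.
by case: (truncP z) => *; nra.
Qed.

(** If [|z| = 2 + y] with [y >= 0], then [8 y <= (2 + y)^2]. With the fourth moment, the mean square
    of the cut-off part is at most 3/64, hence below [(1/4)^2]. *)
Lemma sqr_rest_le z : (z - trunc z) ^+ 2 <= z ^+ 4 / 64.
Proof.
have H (y : R) : 0 <= y -> (z = 2 + y) \/ (z = - 2 - y) -> y ^+ 2 <= z ^+ 4 / 64.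
  move=> y0 e; have -> : z ^+ 4 = ((2 + y) ^+ 2) ^+ 2.
    by case: e => ->; ring.
  have h : 8 * y <= (2 + y) ^+ 2 by have := sqr_ge0 (2 - y); lra.
  have : (8 * y) ^+ 2 <= ((2 + y) ^+ 2) ^+ 2.
    by rewrite ler_sqr // nnegrE ?sqr_ge0 //; lra.
  by rewrite exprMn; lra.
have z4 : 0 <= z ^+ 4 by rewrite exprn_even_ge0.
case: (truncP z) => hz.
- by rewrite subrr expr0n /=; lra.
- by apply: H; [|left]; lra.
- have -> : (z - -2) ^+ 2 = (- 2 - z) ^+ 2 by ring.
  by apply: H; [|right]; lra.
Qed.

(** With tr for truncation, X Y = tr X tr Y + (X - tr X) tr Y + X (Y - tr Y). The first term
    averages box forms at points of height 2, costing [4 * B]; each of the others pairs norms at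
    most 1 and 1/4, costing [c / 4]. *)
Lemma hilbert_bound_step (B c : R) :
  box_bound B -> hilbert_bound c -> hilbert_bound (4 * B + c / 2).
Proof.
move=> boxB hc I u v u1 v1.
pose O := {ffun I -> bool}; pose N : R := #|{: O}|%:R.
have N0 : 0 < N by rewrite ltr0n; apply/card_gt0P; exists [ffun=> true].
pose X i (e : O) := rsum (enum I) (u i) e; pose Y j (e : O) := rsum (enum I) (v j) e.
have EXY i j : \sum_e X i e * Y j e = N * ipf (u i) (v j).
  by rewrite sum_rsumM ?enum_uniq // /ipf big_enum.
have trunc_small (w : I -> R) : ipf w w <= 1 ->
    \sum_(e : O) trunc (rsum (enum I) w e) ^+ 2 <= N.
  move=> w1; apply: (@le_trans _ _ (\sum_(e : O) rsum (enum I) w e * rsum (enum I) w e)).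
    by apply: ler_sum => e _; rewrite -expr2 sqr_trunc_le.
  by rewrite sum_rsumM ?enum_uniq // -[leRHS]mulr1 ler_pM2l // big_enum.
have rest_small (w : I -> R) : ipf w w <= 1 ->
    \sum_(e : O) (rsum (enum I) w e - trunc (rsum (enum I) w e)) ^+ 2 <= N / 16.
  move=> w1; apply: (@le_trans _ _ (\sum_(e : O) rsum (enum I) w e ^+ 4 / 64)).
    by apply: ler_sum => e _; exact: sqr_rest_le.
  rewrite -mulr_suml.
  have := sum_rsum4_le w (enum_uniq I); rewrite -/N.
  rewrite [X in X ^+ 2](_ : _ = ipf w w); last first.
    by rewrite big_enum /=; apply: eq_bigr => i _; rewrite expr2.
  have : ipf w w ^+ 2 <= 1 by rewrite expr_le1 // ipf_ge0.
  set s := ipf w w ^+ 2; set S := \sum_e _ => s1 hS.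
  have : 3 * N * s <= 3 * N by rewrite ler_piMr //; lra.
  lra.
pose a := Num.sqrt N^-1.
have a2 : a ^+ 2 = N^-1 by rewrite sqr_sqrtr // invr_ge0 ltW.
have split3 : \sum_i \sum_j M i j * ipf (u i) (v j) =
   N^-1 * (\sum_e \sum_i \sum_j M i j * (trunc (X i e) * trunc (Y j e)))
 + (\sum_i \sum_j M i j * ipf (fun e => a * (X i e - trunc (X i e))) (fun e => a * trunc (Y j e))
 + \sum_i \sum_j M i j * ipf (fun e => a * X i e) (fun e => a * (Y j e - trunc (Y j e)))).
  rewrite [X in N^-1 * X]exchange_big /= mulr_sumr -!big_split /=; apply: eq_bigr => i _.
  rewrite [X in N^-1 * X]exchange_big /= mulr_sumr -!big_split /=; apply: eq_bigr => j _.
  rewrite !ipfZ a2.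
  have -> : ipf (u i) (v j) = N^-1 * \sum_e X i e * Y j e.
    by rewrite EXY mulKf ?gt_eqF.
  rewrite -mulr_sumr /ipf.
  set s := \sum_e X i e * Y j e; set s1 := \sum_e _; set s2 := \sum_e _; set s3 := \sum_e _.
  have -> : s = s1 + (s2 + s3).
    by rewrite /s /s1 /s2 /s3 -!big_split /=; apply: eq_bigr => e _; ring.
  by ring.
have box_part : `|N^-1 * (\sum_e \sum_i \sum_j M i j * (trunc (X i e) * trunc (Y j e)))| <= 4 * B.
  have Ni : 0 <= N^-1 by rewrite invr_ge0 ltW.
  rewrite normrM (ger0_norm Ni) ler_pdivrMl // (le_trans (ler_norm_sum _ _ _)) //.
  have -> : N * (4 * B) = \sum_(e : O) 4 * B by rewrite sumr_const /N mulr_natl.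
  apply: ler_sum => e _.
  have := boxB (fun i => trunc (X i e) / 2) (fun j => trunc (Y j e) / 2).
  set S := \sum_i _; have -> : \sum_i \sum_j M i j * (trunc (X i e) * trunc (Y j e)) = 4 * S.
    rewrite /S mulr_sumr; apply: eq_bigr => i _; rewrite mulr_sumr; apply: eq_bigr => j _.
    by field.
  move=> /(_ _ _)/le_trans h; rewrite normrM (ger0_norm (_ : 0 <= 4)) // ler_pM2l // h // => k.
    by rewrite normrM normfV (ger0_norm (_ : 0 <= 2)) // ler_pdivrMr // mul1r trunc_le2.
  by rewrite normrM normfV (ger0_norm (_ : 0 <= 2)) // ler_pdivrMr // mul1r trunc_le2.
have unit_scale (w : O -> R) (b : R) : 0 < b -> \sum_e w e ^+ 2 <= N * b ^+ 2 ->
    ipf (fun e => b^-1 * (a * w e)) (fun e => b^-1 * (a * w e)) <= 1.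
  move=> b0 h; rewrite !ipfZ a2 exprVn mulrA -invfM mulrC ler_pdivrMr.
    by rewrite mul1r mulrC; move: h; under eq_bigr do rewrite expr2.
  by rewrite mulr_gt0 ?exprn_gt0.
have small_part (x : 'I_m -> O -> R) (y : 'I_n -> O -> R) (b1 b2 : R) :
    0 < b1 -> 0 < b2 -> b1 * b2 = 4^-1 ->
    (forall i, \sum_e x i e ^+ 2 <= N * b1 ^+ 2) ->
    (forall j, \sum_e y j e ^+ 2 <= N * b2 ^+ 2) ->
    `|\sum_i \sum_j M i j * ipf (fun e => a * x i e) (fun e => a * y j e)| <= c / 4.
  move=> b10 b20 b12 hx hy.
  have := hc _ (fun i e => b1^-1 * (a * x i e)) (fun j e => b2^-1 * (a * y j e))
    (fun i => unit_scale _ _ b10 (hx i)) (fun j => unit_scale _ _ b20 (hy j)).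
  set S := \sum_i _; have -> : \sum_i \sum_j M i j * ipf (fun e => a * x i e) (fun e => a * y j e) = S / 4.
    rewrite /S mulr_suml; apply: eq_bigr => i _; rewrite mulr_suml; apply: eq_bigr => j _.
    rewrite -b12 -mulrA; congr (_ * _); rewrite /ipf mulr_suml; apply: eq_bigr => e _.
    by field; rewrite !gt_eqF.
  by move=> h; rewrite normrM normfV (ger0_norm (_ : 0 <= 4)) // ler_pM2r // invr_gt0.
have one2 : N * 1 ^+ 2 = N by rewrite expr1n mulr1.
have quarter2 : N * 4^-1 ^+ 2 = N / 16 by field.
have full (w : I -> R) : ipf w w <= 1 -> \sum_(e : O) rsum (enum I) w e ^+ 2 <= N.
  move=> w1; under eq_bigr do rewrite expr2.
  by rewrite sum_rsumM ?enum_uniq // -[leRHS]mulr1 ler_pM2l // big_enum.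
rewrite split3 (le_trans (ler_normD _ _)) // lerD //.
rewrite (le_trans (ler_normD _ _)) //.
have -> : c / 2 = c / 4 + c / 4 by field.
apply: lerD.
- apply: (small_part _ _ 4^-1 1)  => //; rewrite ?mulr1 ?invr_gt0 //.
  + by move=> i; rewrite quarter2; apply: rest_small.
  + by move=> j; rewrite one2; apply: trunc_small.
- apply: (small_part _ _ 1 4^-1)  => //; rewrite ?mul1r ?invr_gt0 //.
  + by move=> i; rewrite one2; apply: full.
  + by move=> j; rewrite quarter2; apply: rest_small.
Qed.

(* Truncating the Rademacher sums at height 2 makes the error terms again
   bilinear forms in vectors, of norms at most 1 and 1/4; iterating the
   resulting self-improvement of the bound gives the constant 8. *)
Theorem grothendieck (B : R) : box_bound B -> hilbert_bound (8 * B).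
Proof.
move=> boxB; pose c0 := \sum_i \sum_j `|M i j|.
have iter k : hilbert_bound (8 * B + (c0 - 8 * B) / 2 ^+ k).
  elim: k => [|k IH].
    rewrite expr0 divr1 addrC subrK; exact: hilbert_bound_trivial.
  rewrite (_ : _ + _ = 4 * B + (8 * B + (c0 - 8 * B) / 2 ^+ k) / 2).
    exact: hilbert_bound_step.
  by rewrite exprS; field; rewrite expf_eq0 pnatr_eq0 andbF.
move=> I u v u1 v1; apply/ler_addgt0Pr => eps e0.
pose z := `|c0 - 8 * B| / eps.
have [k hk] : exists k, z < 2 ^+ k.
  exists (Num.bound z); apply: lt_le_trans (archi_boundP _) _; first by rewrite divr_ge0 // ltW.
  by rewrite -natrX ler_nat ltnW // ltn_expl.
apply: le_trans (iter k I u v u1 v1) _; rewrite lerD2l ler_pdivrMr ?exprn_gt0 //.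
apply: le_trans (ler_norm _) _; rewrite (mulrC eps) -ler_pdivrMr //.
exact: ltW.
Qed.

End Grothendieck.

(** * Edge switchings in regular graphs *)

Section Edges.
Variable n : nat.
Implicit Types (x y u v : 'I_n) (e : {set 'I_n}) (E : {set {set 'I_n}}).

Definition edge x y : {set 'I_n} := (x |: [set y])%SET.

Lemma edgeC x y : edge x y = edge y x. Proof. exact: finset.setUC. Qed.

Lemma in_edge i x y : (i \in edge x y) = (i == x) || (i == y).
Proof. by rewrite !inE. Qed.

Lemma adjE E x y : adj E x y = (x != y) && (edge x y \in E). Proof. by []. Qed.

Lemma adjC E x y : adj E x y = adj E y x.
Proof. by rewrite !adjE eq_sym edgeC. Qed.

Lemma edge_eq x y u v : edge x y = edge u v -> (x = u /\ y = v) \/ (x = v /\ y = u).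
Proof.
move=> e.
have hx : (x == u) || (x == v) by rewrite -in_edge -e in_edge eqxx.
have hy : (y == u) || (y == v) by rewrite -in_edge -e in_edge eqxx orbT.
have hu : (u == x) || (u == y) by rewrite -in_edge e in_edge eqxx.
have hv : (v == x) || (v == y) by rewrite -in_edge e in_edge eqxx orbT.
case/orP: hx => /eqP hx; case/orP: hy => /eqP hy; subst; first by left; case/orP: hv => /eqP.
- by left.
- by right.
- by right; case/orP: hu => /eqP.
Qed.

Lemma simple_edgeP E e : is_simple_graph E -> e \in E ->
  exists x y, x != y /\ e = edge x y.
Proof.
by move=> /forallP/(_ e)/implyP h /h /cards2P[x [y [xy ->]]]; exists x, y.
Qed.

Lemma card_edge x y : x != y -> #|edge x y| = 2%N.
Proof. by move=> xy; rewrite /edge cardsU1 inE xy cards1. Qed.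

Definition quad := (('I_n * 'I_n) * ('I_n * 'I_n))%type.

Definition switchable E (q : quad) : bool :=
  let: ((x, y), (u, v)) := q in
  [&& adj E x y, adj E u v, x != v, u != y, ~~ adj E x v & ~~ adj E u y].

Definition switch E (q : quad) : {set {set 'I_n}} :=
  let: ((x, y), (u, v)) := q in
  (edge x v |: (edge u y |: (E :\ edge x y :\ edge u v)))%SET.

Definition unswitch (q : quad) : quad :=
  let: ((x, y), (u, v)) := q in ((x, v), (u, y)).

Lemma unswitchK : involutive unswitch.
Proof. by case=> [[x y] [u v]]. Qed.

(** [x = u] would turn the edge uv into the non-edge xv, and [y = v] would turn it into the non-edge
    uy. *)
Lemma switchable_neq E x y u v : switchable E ((x, y), (u, v)) ->
  [/\ x != y, u != v, x != u & y != v] /\ [/\ x != v & u != y].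
Proof.
case/and5P=> /andP[xy Exy] /andP[uv Euv] xv uy /andP[nxv nuy].
split=> //; split=> //.
  by apply: contraNneq nxv => xu; rewrite adjE xv xu.
by apply: contraNneq nuy => yv; rewrite adjE uy yv.
Qed.

Lemma switchable_edges E x y u v : switchable E ((x, y), (u, v)) ->
  [/\ edge x y \in E, edge u v \in E, edge x v \notin E & edge u y \notin E] /\
  [/\ edge x y != edge u v, edge x v != edge u y,
      edge x y != edge x v & edge x y != edge u y] /\
  [/\ edge u v != edge x v & edge u v != edge u y].
Proof.
move=> sw; have [[xy uv xu yv] [xv uy]] := switchable_neq sw.
case/and5P: sw => /andP[_ Exy] /andP[_ Euv] _ _ /andP[].
rewrite !adjE xv uy /= => nxv nuy.
have ne a b c d : a != c -> a != d -> edge a b != edge c d.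
  by move=> ac ad; apply/eqP => /edge_eq[[h _]|[h _]]; rewrite h eqxx in ac ad.
split=> //; split.
  split; first exact: ne.
  - exact: ne.
  - by rewrite edgeC [edge x v]edgeC; apply: ne => //; rewrite eq_sym.
  - exact: ne.
split; first by apply: ne => //; rewrite eq_sym.
by rewrite edgeC [edge u y]edgeC; apply: ne => //; rewrite eq_sym // eq_sym.
Qed.

(** Covers every additive edge statistic: membership of a vertex gives the degrees (in [int]),
    [edge_weight] gives the cut sizes (in [R]). *)
Lemma sum_switch (V : zmodType) E x y u v (F : {set 'I_n} -> V) :
  switchable E ((x, y), (u, v)) ->
  \sum_(e in switch E ((x, y), (u, v))) F e =
    \sum_(e in E) F e - F (edge x y) - F (edge u v) + F (edge x v) + F (edge u y).
Proof.
move=> sw.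
have [[Exy Euv nxv nuy] [[d1 d2 d3 d4] [d5 d6]]] := switchable_edges sw.
rewrite /switch big_setU1 ?big_setU1; last 2 first.
- by rewrite !inE (negPf nuy) !andbF.
- by rewrite !inE (negPf d2) (negPf nxv) !andbF.
have euv' : edge u v \in (E :\ edge x y)%SET by rewrite !inE eq_sym d1 Euv.
rewrite (big_setD1 (edge x y) Exy) (big_setD1 (edge u v) euv') /=.
set a := F (edge x y); set b := F (edge u v); set c := \sum_(e in _) F e.
rewrite [a + _]addrC addrK [b + c]addrC addrK.
by rewrite [RHS]addrC addrCA [c + _]addrC.
Qed.

Lemma mem_switch E x y u v e :
  (e \in switch E ((x, y), (u, v))) = [|| e == edge x v, e == edge u y |
                          [&& e != edge u v, e != edge x y & e \in E]].
Proof. by rewrite !inE. Qed.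

Lemma switch_simple E q : switchable E q ->
  is_simple_graph E -> is_simple_graph (switch E q).
Proof.
case: q => [[x y] [u v]] sw /forallP sE.
have [_ [xv uy]] := switchable_neq sw.
apply/forallP => e; apply/implyP.
rewrite mem_switch.
case/or3P=> [/eqP->|/eqP->|/and3P[_ _ eE]]; rewrite ?card_edge //.
exact: (implyP (sE e)).
Qed.

Lemma switchK E q : switchable E q -> switch (switch E q) (unswitch q) = E.
Proof.
case: q => [[x y] [u v]] sw.
have [[Exy Euv nxv nuy] [[d1 d2 d3 d4] [d5 d6]]] := switchable_edges sw.
apply/setP => e; rewrite !mem_switch.
have [->|exy] := eqVneq e (edge x y); first by rewrite Exy.
have [->|euv] := eqVneq e (edge u v); first by rewrite Euv.
have [->|exv] := eqVneq e (edge x v); first by rewrite andbF (negPf nxv).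
have [->|euy] := eqVneq e (edge u y); first by rewrite (negPf nuy).
by [].
Qed.

Lemma switchable_unswitch E q : switchable E q ->
  switchable (switch E q) (unswitch q).
Proof.
case: q => [[x y] [u v]] sw.
have [[Exy Euv nxv nuy] [[d1 d2 d3 d4] [d5 d6]]] := switchable_edges sw.
have [[xy uv xu yv] [xv uy]] := switchable_neq sw.
rewrite /switchable /unswitch !adjE xv uy xy uv /= !mem_switch.
rewrite !eqxx /= !andbF /= !orbF !negb_or d3 d4 d5 d6 orbT //.
Qed.

Lemma switch_regular (r : nat) E q : switchable E q ->
  is_regular_graph r E -> is_regular_graph r (switch E q).
Proof.
move=> sw /andP[sE /forallP dE]; apply/andP; split; first exact: switch_simple.
(* Degrees are counted in [int], where removed edges can be subtracted. *)
have deg E' i : #|[set e in E' | i \in e]|%:Z = \sum_(e in E') (i \in e)%:Z.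
  rewrite cardsE -sum1_card -natz natr_sum big_mkcondr /=.
    by apply: eq_bigr => e _; case: (i \in e).
apply/forallP => i; rewrite -(inj_eq (can_inj absz_nat)) deg.
case: q sw => [[x y] [u v]] sw; have [[xy uv xu yv] [xv uy]] := switchable_neq sw.
rewrite sum_switch // -deg (eqP (dE i)) !in_edge.
have h a b : a != b -> ((i == a) || (i == b))%:Z = (i == a)%:Z + (i == b)%:Z :> int.
  by move=> ab; have [->|_] := eqVneq i a; rewrite ?(negPf ab).
rewrite !h //; apply/eqP; ring.
Qed.

End Edges.

Section Weights.
Variables (R : realType) (n : nat).
Implicit Types (x y u v i j : 'I_n) (e : {set 'I_n}) (E : {set {set 'I_n}}).
Implicit Types (w : 'I_n -> 'I_n -> R).

(** Symmetrises [w] over an unordered edge, so that sums over ordered adjacent pairs become sums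
    over [E], to which [sum_switch] applies. *)
Definition edge_weight w e : R := \sum_(i in e) \sum_(j in e | i != j) w i j.

Lemma edge_weightE w x y : x != y -> edge_weight w (edge x y) = w x y + w y x.
Proof.
move=> xy; have nx : x \notin [set y]%SET by rewrite inE.
rewrite /edge_weight /edge big_setU1 //= big_set1; congr (_ + _).
  by rewrite big_mkcondr big_setU1 //= big_set1 eqxx xy add0r.
by rewrite big_mkcondr big_setU1 //= big_set1 eqxx eq_sym xy addr0.
Qed.

Lemma sum_edge_weight E w : is_simple_graph E ->
  \sum_(e in E) edge_weight w e = \sum_i \sum_j w i j * (adj E i j)%:R.
Proof.
move=> sE; rewrite /edge_weight.
under eq_bigr do rewrite big_mkcond.
rewrite exchange_big /=; apply: eq_bigr => i _.
rewrite (eq_bigr (fun e => \sum_j ((i \in e) && (j \in e) && (i != j))%:R * w i j)); last first.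
  move=> e _; case: (i \in e); last by rewrite /= big1 // => j _; rewrite mul0r.
  rewrite big_mkcond; apply: eq_bigr => j _ /=.
  by case: ifP => _; rewrite ?mul1r ?mul0r.
rewrite exchange_big /=; apply: eq_bigr => j _.
rewrite -mulr_suml mulrC; congr (_ * _); rewrite adjE.
have [ij|ij] /= := eqVneq i j.
  by rewrite big1 // => e _; rewrite andbF.
have inc e : e \in E -> (i \in e) && (j \in e) = (e == edge i j).
  move=> eE; have [x [y [xy ->]]] := simple_edgeP sE eE.
  rewrite !in_edge; apply/andP/eqP => [[]|/edge_eq[[-> ->]|[-> ->]]]; last 2 first.
  - by rewrite !eqxx orbT.
  - by rewrite !eqxx orbT.
  case/orP=> /eqP hi; case/orP=> /eqP hj; subst; rewrite ?eqxx // in ij *.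
  exact: edgeC.
under eq_bigr => e eE do rewrite andbT inc //.
have [ijE|ijE] := boolP (edge i j \in E).
  by rewrite (big_setD1 _ ijE) /= eqxx big1 ?addr0 // => e; rewrite !inE => /andP[/negPf->].
by rewrite big1 // => e eE; case: eqP => // h; rewrite -h eE in ijE.
Qed.

Lemma sum_adj (r : nat) E x : is_regular_graph r E -> \sum_y (adj E x y)%:R = r%:R :> R.
Proof.
move=> /andP[sE /forallP/(_ x)/eqP <-].
transitivity (\sum_i \sum_j ((i == x)%:R : R) * (adj E i j)%:R).
  rewrite [RHS](bigD1 x) //= [X in _ + X]big1 ?addr0; last first.
    by move=> i /negPf ix; rewrite big1 // => j _; rewrite ix mul0r.
  by apply: eq_bigr => y _; rewrite eqxx mul1r.
rewrite -sum_edge_weight // cardsE -sum1_card natr_sum big_mkcondr /=.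
apply: eq_bigr => e eE; have [a [b [ab ->]]] := simple_edgeP sE eE.
rewrite edge_weightE // in_edge ![_ == x]eq_sym.
by have [->|xa] := eqVneq x a; rewrite ?(negPf ab) ?addr0 ?add0r //=; case: eqP.
Qed.

Definition cutE E (S T : {set 'I_n}) : R := \sum_(i in S) \sum_(j in T) (adj E i j)%:R.

Variables S T : {set 'I_n}.

Definition ind x y : R := (x \in S)%:R * (y \in T)%:R.
Definition sind x y : R := ind x y + ind y x.

Lemma ind_ge0 x y : 0 <= ind x y. Proof. by rewrite mulr_ge0. Qed.

Lemma sind_ge0 x y : 0 <= sind x y. Proof. by rewrite addr_ge0 // ind_ge0. Qed.

Lemma sind_le2 x y : sind x y <= 2.
Proof.
rewrite /sind /ind; do 4! case: (_ \in _); rewrite /= ?mulr0 ?mul0r ?mulr1 ?addr0; lra.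
Qed.

(** Only the endpoint [x] is kept, so that non-switchable quadruples can be charged to single
    vertices of S and T. *)
Lemma sind_le x y : sind x y <= (x \in S)%:R + (x \in T)%:R.
Proof.
rewrite /sind /ind; do 4! case: (_ \in _); rewrite /= ?mulr0 ?mul0r ?mulr1 ?addr0; lra.
Qed.

Lemma cutE_sum E : cutE E S T = \sum_i \sum_j ind i j * (adj E i j)%:R.
Proof.
rewrite /cutE big_mkcond /=; apply: eq_bigr => i _.
rewrite /ind; case: (i \in S); last by rewrite big1 // => j _; rewrite !mul0r.
rewrite big_mkcond /=; apply: eq_bigr => j _; rewrite mul1r.
by case: ifP; rewrite ?mul1r ?mul0r.
Qed.

Lemma sum_sind_adj E : \sum_i \sum_j sind i j * (adj E i j)%:R = 2 * cutE E S T.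
Proof.
rewrite cutE_sum mulr_natl mulr2n.
under eq_bigr do under eq_bigr do rewrite mulrDl.
under eq_bigr do rewrite big_split /=.
rewrite big_split /=; congr (_ + _); rewrite exchange_big /=.
by apply: eq_bigr => i _; apply: eq_bigr => j _; rewrite adjC.
Qed.

Lemma sum_mem (U : {set 'I_n}) : \sum_i (i \in U)%:R = #|U|%:R :> R.
Proof.
rewrite -sum1_card natr_sum [RHS]big_mkcond /=.
by apply: eq_bigr => i _; case: ifP.
Qed.

Lemma sum_ind : \sum_i \sum_j ind i j = #|S|%:R * #|T|%:R.
Proof.
rewrite /ind; under eq_bigr do rewrite -mulr_sumr.
by rewrite -mulr_suml !sum_mem.
Qed.

Lemma sum_sind : \sum_i \sum_j sind i j = 2 * (#|S|%:R * #|T|%:R).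
Proof.
rewrite mulr_natl mulr2n -!sum_ind /sind.
under eq_bigr do rewrite big_split /=.
by rewrite big_split /= [X in _ + X]exchange_big.
Qed.

Lemma cutE_switch E x y u v : is_simple_graph E -> switchable E ((x, y), (u, v)) ->
  cutE E S T - cutE (switch E ((x, y), (u, v))) S T =
  sind x y + sind u v - sind x v - sind u y.
Proof.
move=> sE sw; rewrite !cutE_sum -!sum_edge_weight ?sum_switch ?switch_simple //.
have [[xy uv xu yv] [xv uy]] := switchable_neq sw.
by rewrite !edge_weightE // -!/(sind _ _); ring.
Qed.

Lemma sum_quad (F : 'I_n -> 'I_n -> 'I_n -> 'I_n -> R) :
  \sum_(q : quad n) F q.1.1 q.1.2 q.2.1 q.2.2 =
  \sum_x \sum_y \sum_u \sum_v F x y u v.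
Proof.
rewrite [RHS]pair_bigA /= [RHS](eq_bigr (fun p : 'I_n * 'I_n =>
  \sum_(p' : 'I_n * 'I_n) F p.1 p.2 p'.1 p'.2)); last by move=> p _; rewrite pair_bigA.
by rewrite pair_bigA.
Qed.

Definition swap_quad (q : quad n) : quad n := (q.2, q.1).

Lemma sum_quad_swap (F : quad n -> R) : \sum_q F (swap_quad q) = \sum_q F q.
Proof.
have swK : involutive swap_quad by case.
by rewrite [RHS](reindex_inj (inv_inj swK)).
Qed.

End Weights.

(** * Drift of a cut size under switchings *)

Section Drift.
Variables (R : realType) (n r : nat) (E : {set {set 'I_n}}) (S T : {set 'I_n}).
Hypothesis regE : is_regular_graph r E.
Implicit Types (x y u v : 'I_n).

Let A x y : R := (adj E x y)%:R.
Let c x : R := (x \in S)%:R + (x \in T)%:R.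
Local Notation s := (@sind R n S T).

Let A_row x : \sum_y A x y = r%:R. Proof. exact: sum_adj. Qed.

Let A_col y : \sum_x A x y = r%:R.
Proof. by rewrite -(A_row y); apply: eq_bigr => x _; rewrite /A adjC. Qed.

Let A_ge0 x y : 0 <= A x y. Proof. exact: ler0n. Qed.

Let c_ge0 x : 0 <= c x. Proof. by rewrite addr_ge0. Qed.

(** Sums over switchable quadruples are computed exactly over all pairs of edges, then corrected by
    the [bad] quadruples. *)
Let both (q : quad n) : R := A q.1.1 q.1.2 * A q.2.1 q.2.2.

Let both_ge0 q : 0 <= both q. Proof. by rewrite mulr_ge0. Qed.

Let both_swap q : both (swap_quad q) = both q. Proof. exact: mulrC. Qed.

Lemma sum_both_edge :
  \sum_q both q * s q.1.1 q.1.2 = r%:R * n%:R * (2 * cutE R E S T).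
Proof.
rewrite (sum_quad (fun x y u v => A x y * A u v * s x y)) -sum_sind_adj mulr_sumr.
apply: eq_bigr => x _; rewrite mulr_sumr; apply: eq_bigr => y _.
rewrite -/(A x y) (eq_bigr (fun u => r%:R * (s x y * A x y))); last first.
  by move=> u _; rewrite -(A_row u) mulr_suml; apply: eq_bigr => v _; ring.
by rewrite sumr_const card_ord -mulr_natl; ring.
Qed.

(** Given x and v, the column and row sums leave r choices of u and r of y, so the edges of the
    graph disappear from the result: this is what drives e(S, T) to its mean. *)
Lemma sum_both_cross :
  \sum_q both q * s q.1.1 q.2.2 = r%:R ^+ 2 * (2 * (#|S|%:R * #|T|%:R)).
Proof.
rewrite (sum_quad (fun x y u v => A x y * A u v * s x v)) -sum_sind mulr_sumr.
apply: eq_bigr => x _; rewrite mulr_sumr.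
rewrite (eq_bigr (fun y => A x y * (\sum_v r%:R * s x v))); last first.
  move=> y _; rewrite exchange_big mulr_sumr; apply: eq_bigr => v _ /=.
  by rewrite -(A_col v) !(mulr_suml, mulr_sumr); apply: eq_bigr => u _; ring.
by rewrite -mulr_suml A_row mulr_sumr; apply: eq_bigr => v _; ring.
Qed.

Lemma sum_both_edge' :
  \sum_q both q * s q.2.1 q.2.2 = r%:R * n%:R * (2 * cutE R E S T).
Proof.
rewrite -sum_both_edge -[RHS]sum_quad_swap.
by apply: eq_bigr => q _; rewrite both_swap.
Qed.

Lemma sum_both_cross' :
  \sum_q both q * s q.2.1 q.1.2 = r%:R ^+ 2 * (2 * (#|S|%:R * #|T|%:R)).
Proof.
rewrite -sum_both_cross -[RHS]sum_quad_swap.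
by apply: eq_bigr => q _; rewrite both_swap.
Qed.

Let c_sum : \sum_x c x = #|S|%:R + #|T|%:R.
Proof. by rewrite big_split /= !sum_mem. Qed.

Let sum_A_sep (f g : 'I_n -> R) :
  \sum_u \sum_v A u v * (f v + g u) = r%:R * (\sum_v f v + \sum_u g u).
Proof.
under eq_bigr do under eq_bigr do rewrite mulrDr.
under eq_bigr do rewrite big_split /=.
rewrite big_split /= mulrDr exchange_big /= !mulr_sumr; congr (_ + _).
  by apply: eq_bigr => v _; rewrite -mulr_suml A_col.
by apply: eq_bigr => u _; rewrite -mulr_suml A_row.
Qed.

Let bad (q : quad n) : R := (~~ switchable E q)%:R.

(** A pair of edges fails to be switchable only if x = v, u = y, or xv or uy is an edge; for a fixed
    edge xy these cases leave r, r, r^2 and r^2 choices of uv. *)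
Lemma sum_bad : \sum_q both q * bad q * c q.1.1 <=
  (2 * r%:R ^+ 2 + 2 * r%:R ^+ 3) * (#|S|%:R + #|T|%:R).
Proof.
apply: (@le_trans _ _ (\sum_q both q * c q.1.1 * ((q.1.1 == q.2.2)%:R
   + (q.2.1 == q.1.2)%:R + A q.1.1 q.2.2 + A q.2.1 q.1.2))).
  apply: ler_sum => -[[x y] [u v]] _ /=.
  rewrite -mulrA [bad _ * _]mulrC mulrA /both /bad /A /=.
  case Exy: (adj E x y); last by rewrite !mul0r.
  case Euv: (adj E u v); last by rewrite mulr0 !mul0r.
  rewrite /= !mul1r; apply: ler_wpM2l => //.
  case: eqP => _; case: eqP => _; case: (adj E x v); case: (adj E u y) => /=; lra.
rewrite (sum_quad (fun x y u v => A x y * A u v * c x * ((x == v)%:R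
   + (u == y)%:R + A x v + A u y))) -c_sum mulr_sumr.
rewrite le_eqVlt; apply/orP; left; apply/eqP; apply: eq_bigr => x _.
have -> : (2 * r%:R ^+ 2 + 2 * r%:R ^+ 3) * c x = \sum_y A x y *
    (c x * (2 * r%:R + 2 * r%:R ^+ 2)).
  by rewrite -mulr_suml A_row; ring.
apply: eq_bigr => y _.
rewrite (_ : \sum_u _ = A x y * (c x *
  \sum_u \sum_v A u v * (((x == v)%:R + A x v) + ((u == y)%:R + A u y)))); last first.
  rewrite !mulr_sumr; apply: eq_bigr => u _; rewrite !mulr_sumr; apply: eq_bigr => v _.
  by ring.
congr (_ * (_ * _)); rewrite sum_A_sep !big_split /= A_row A_col.
have one (f : 'I_n -> 'I_n -> bool) z : (forall t, f z t = (t == z)) ->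
    \sum_t (f z t)%:R = 1 :> R.
  move=> fE; rewrite (bigD1 z) //= fE eqxx big1 ?addr0 // => t /negPf tz.
  by rewrite fE tz.
rewrite (one (fun a b => a == b)) 1?(one (fun a b => b == a)) //.
by ring.
Qed.

Definition cut_drop (q : quad n) : R :=
  s q.1.1 q.1.2 + s q.2.1 q.2.2 - s q.1.1 q.2.2 - s q.2.1 q.1.2.

Definition cut_variation (q : quad n) : R :=
  s q.1.1 q.1.2 + s q.2.1 q.2.2 + s q.1.1 q.2.2 + s q.2.1 q.1.2.

Lemma cutE_sub_switch (q : quad n) : switchable E q ->
  cutE R E S T - cutE R (switch E q) S T = cut_drop q.
Proof.
have /andP[sE _] := regE; case: q => [[x y] [u v]] sw.
by rewrite cutE_switch.
Qed.

Lemma norm_cut_drop q : `|cut_drop q| <= cut_variation q.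
Proof.
rewrite /cut_drop /cut_variation ler_norml.
have := sind_ge0 R S T q.1.1 q.1.2; have := sind_ge0 R S T q.2.1 q.2.2.
have := sind_ge0 R S T q.1.1 q.2.2; have := sind_ge0 R S T q.2.1 q.1.2.
lra.
Qed.

Lemma cut_variation_le q : cut_variation q <= 2 * (c q.1.1 + c q.2.1).
Proof.
rewrite /cut_variation /c.
have := sind_le R S T q.1.1 q.1.2; have := sind_le R S T q.2.1 q.2.2.
have := sind_le R S T q.1.1 q.2.2; have := sind_le R S T q.2.1 q.1.2.
lra.
Qed.

Let bothE q (h : R) : switchable E q -> both q * h = h.
Proof.
case: q => [[x y] [u v]] /and5P[xy uv _ _ _].
by rewrite /both /A /= xy uv !mul1r.
Qed.

Lemma sum_switchable (h : quad n -> R) :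
  \sum_(q | switchable E q) h q = \sum_q both q * h q - \sum_q both q * bad q * h q.
Proof.
rewrite -sumrB big_mkcond; apply: eq_bigr => q _.
case: ifPn => sw; rewrite /bad ?sw ?(negPf sw) /=.
  by rewrite bothE // mulr0 mul0r subr0.
by rewrite mulr1 subrr.
Qed.

Lemma sum_switchable_variation : \sum_(q | switchable E q) cut_variation q <=
  4 * r%:R * (n%:R * cutE R E S T + r%:R * (#|S|%:R * #|T|%:R)).
Proof.
rewrite sum_switchable lerBlDr.
have -> : \sum_q both q * cut_variation q =
    4 * r%:R * (n%:R * cutE R E S T + r%:R * (#|S|%:R * #|T|%:R)).
  rewrite (eq_bigr (fun q => both q * s q.1.1 q.1.2 + both q * s q.2.1 q.2.2
    + both q * s q.1.1 q.2.2 + both q * s q.2.1 q.1.2)); last first.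
    by move=> q _; rewrite /cut_variation -!mulrDr.
  rewrite !big_split /= sum_both_edge sum_both_edge' sum_both_cross sum_both_cross'.
  by ring.
rewrite lerDl; apply: sumr_ge0 => q _; rewrite !mulr_ge0 ?ler0n //.
exact: le_trans (normr_ge0 _) (norm_cut_drop q).
Qed.

(** The main term is [4 r n] times the deviation of e(S, T) from its mean. The error, charged to
    vertices of S and T, is linear in [m]: the higher levels need it to shrink with the sets. *)
Lemma sum_switchable_drop (m : R) : (0 < r)%N -> #|S|%:R <= m -> #|T|%:R <= m ->
  `|\sum_(q | switchable E q) cut_drop q
    - 4 * r%:R * (n%:R * cutE R E S T - r%:R * (#|S|%:R * #|T|%:R))| <=
  32 * m * r%:R ^+ 3.
Proof.
move=> r0 Sm Tm; rewrite sum_switchable.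
have -> : \sum_q both q * cut_drop q =
    4 * r%:R * (n%:R * cutE R E S T - r%:R * (#|S|%:R * #|T|%:R)).
  rewrite (eq_bigr (fun q => both q * s q.1.1 q.1.2 + both q * s q.2.1 q.2.2
    - both q * s q.1.1 q.2.2 - both q * s q.2.1 q.1.2)); last first.
    by move=> q _; rewrite /cut_drop -mulrDr -!mulrBr.
  rewrite 2!sumrB big_split /= sum_both_edge sum_both_edge' sum_both_cross sum_both_cross'.
  by ring.
rewrite addrAC subrr add0r normrN.
apply: le_trans (ler_norm_sum _ _ _) _.
apply: (@le_trans _ _ (\sum_q both q * bad q * (2 * (c q.1.1 + c q.2.1)))).
  apply: ler_sum => q _; rewrite normrM ger0_norm ?mulr_ge0 //.
  apply: ler_wpM2l; first by rewrite mulr_ge0.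
  exact: le_trans (norm_cut_drop q) (cut_variation_le q).
have bad_swap q : bad (swap_quad q) = bad q.
  case: q => [[x y] [u v]]; rewrite /bad /switchable /=; congr (~~ _)%:R.
  by case: (adj E x y); case: (adj E u v); case: (x != v); case: (u != y);
    case: (adj E x v); case: (adj E u y).
have -> : \sum_q both q * bad q * (2 * (c q.1.1 + c q.2.1)) =
    4 * \sum_q both q * bad q * c q.1.1.
  under eq_bigr do rewrite mulrDr mulrDr.
  rewrite big_split /= -[X in _ + X]sum_quad_swap -big_split /= mulr_sumr.
  by apply: eq_bigr => q _; rewrite both_swap bad_swap /=; ring.
have := sum_bad; set B := \sum_q _ => hB.
have r1 : 1 <= r%:R :> R by rewrite ler1n.
have rr : r%:R ^+ 2 <= r%:R ^+ 3 :> R by rewrite (exprSr _ 2) ler_peMr ?exprn_ge0.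
have r3 : 0 <= r%:R ^+ 3 :> R by rewrite exprn_ge0.
have h1 : (2 * r%:R ^+ 2 + 2 * r%:R ^+ 3) * (#|S|%:R + #|T|%:R) <=
    4 * r%:R ^+ 3 * (#|S|%:R + #|T|%:R) :> R.
  by apply: ler_wpM2r; [rewrite addr_ge0 | lra].
have h2 : 4 * r%:R ^+ 3 * (#|S|%:R + #|T|%:R) <= 4 * r%:R ^+ 3 * (m + m) :> R.
  by apply: ler_wpM2l; [lra | exact: lerD].
lra.
Qed.

End Drift.

(** * Tails of the number of edges between two sets *)

Definition regular_graphs (n r : nat) : {set {set {set 'I_n}}} :=
  [set E | is_regular_graph r E].

Section Flow.
Variables (R : realType) (n r : nat).
Local Notation G := (regular_graphs n r).

Let state := ({set {set 'I_n}} * quad n)%type.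

(** Extended by the identity where no switching is possible, to be an involution of the whole finite
    type, as the reindexing in [switch_flow] requires. *)
Let move_state (p : state) : state :=
  if (p.1 \in G) && switchable p.1 p.2 then (switch p.1 p.2, unswitch p.2) else p.

Let moveK : involutive move_state.
Proof.
case=> E q; rewrite /move_state /=; case h: ((E \in G) && switchable E q) => /=; last by rewrite h.
case/andP: h => EG sw; rewrite inE in EG.
by rewrite inE switch_regular // switchable_unswitch // switchK // unswitchK.
Qed.

(* Moves that stay above the level t come in pairs that cancel, so the total
   cut_drop from above t is carried by the graphs just above t. *)
Lemma switch_flow (g : {set {set 'I_n}} -> R) (t b : R) :
  (forall E q, E \in G -> switchable E q -> `|g E - g (switch E q)| <= b) ->
  \sum_(E in G | t <= g E) \sum_(q | switchable E q) (g E - g (switch E q)) <=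
  \sum_(E in G | t <= g E < t + b) \sum_(q | switchable E q) `|g E - g (switch E q)|.
Proof.
move=> gb; rewrite !pair_big_dep /=.
rewrite (bigID (fun p : state => t <= g (switch p.1 p.2))) /=.
set A := \sum_(p | _) _; have -> : A = 0.
  suff : A = - A by lra.
  rewrite {1}/A (reindex_inj (inv_inj moveK)) -sumrN; apply: eq_big => [[E q]|[E q]] /=.
    rewrite /move_state /=; case: ifPn => [/andP[EG sw]|/negPf //] /=.
    rewrite switchK // EG sw switchable_unswitch //; move: EG; rewrite !inE => EG.
    by rewrite switch_regular //=; rewrite !andbT andbC.
  rewrite /move_state /=; case: ifPn => [/andP[EG sw] _|nsw] /=.
    by rewrite switchK // opprB.
  by rewrite -!andbA andbCA => /andP[_] /andP[h1] /andP[h2 _]; rewrite h1 h2 in nsw.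
rewrite add0r big_mkcond [leRHS]big_mkcond; apply: ler_sum => -[E q] _ /=.
case: ifP => [/andP[/andP[/andP[EG tE] sw]]|_].
  rewrite -ltNge => st; rewrite EG sw tE /=.
  rewrite (_ : g E < t + b) ?ler_norm //.
  have := gb E q EG sw; have := ler_norm (g E - g (switch E q)); lra.
by case: ifP.
Qed.

End Flow.

Section Tail.
Variables (R : realType) (n r : nat) (S T : {set 'I_n}) (m : R) (sg : bool).
Hypotheses (n0 : (0 < n)%N) (r0 : (0 < r)%N).
Hypotheses (Sm : #|S|%:R <= m) (Tm : #|T|%:R <= m).
Local Notation G := (regular_graphs n r).

Definition cut_mean : R := r%:R / n%:R * (#|S|%:R * #|T|%:R).
Local Notation mu := cut_mean.

(** The sign [sg] treats the upper and the lower tail together. *)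
Definition deviation (E : {set {set 'I_n}}) : R := (-1) ^+ sg * (cutE R E S T - mu).
Local Notation g := deviation.

Definition ntail (t : R) : R := #|[set E in G | t <= g E]|%:R.

Let nR : 0 < n%:R :> R. Proof. by rewrite ltr0n. Qed.
Let rR : 0 < r%:R :> R. Proof. by rewrite ltr0n. Qed.
Let mu_ge0 : 0 <= mu. Proof. by rewrite /mu !mulr_ge0 ?invr_ge0. Qed.

Lemma ntail_ge0 t : 0 <= ntail t. Proof. exact: ler0n. Qed.

Lemma ntail_mono t t' : t <= t' -> ntail t' <= ntail t.
Proof.
move=> tt; rewrite ler_nat subset_leq_card //; apply/fintype.subsetP => E.
by rewrite !inE => /andP[-> /(le_trans tt)].
Qed.

Lemma ntail_le t : ntail t <= #|G|%:R.
Proof.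
rewrite ler_nat subset_leq_card //; apply/fintype.subsetP => E.
by rewrite !inE => /andP[].
Qed.

Let drop_eq E q : E \in G -> switchable E q ->
  g E - g (switch E q) = (-1) ^+ sg * cut_drop R S T q.
Proof.
rewrite inE => EG sw; rewrite -(cutE_sub_switch R S T EG sw) /deviation; ring.
Qed.

Let drop_norm E q : E \in G -> switchable E q ->
  `|g E - g (switch E q)| = `|cut_drop R S T q|.
Proof. by move=> EG sw; rewrite drop_eq // normrMsign. Qed.

Let drop_le4 (q : quad n) : `|cut_drop R S T q| <= 4.
Proof.
rewrite /cut_drop ler_norml.
have := sind_ge0 R S T q.1.1 q.1.2; have := sind_ge0 R S T q.2.1 q.2.2.
have := sind_ge0 R S T q.1.1 q.2.2; have := sind_ge0 R S T q.2.1 q.1.2.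
have := sind_le2 R S T q.1.1 q.1.2; have := sind_le2 R S T q.2.1 q.2.2.
have := sind_le2 R S T q.1.1 q.2.2; have := sind_le2 R S T q.2.1 q.1.2.
lra.
Qed.

Let ntail_diff t b : 0 <= b ->
  #|[set E in G | t <= g E < t + b]|%:R = ntail t - ntail (t + b).
Proof.
move=> b0; rewrite /ntail -!sum1_card !natr_sum.
rewrite [X in _ = X - _](bigID (fun E => t + b <= g E)) /=.
rewrite (_ : \sum_(i in _ | t + b <= g i) _ = \sum_(E in [set E in G | t + b <= g E]%SET) 1).
  rewrite addrC addrK; apply: eq_bigl => E; rewrite !inE -ltNge.
  by rewrite andbA.
apply: eq_bigl => E; rewrite !inE -andbA; congr (_ && _).
by apply/andP/idP => [[]//|h]; split => //; apply: le_trans h; rewrite lerDl.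
Qed.

(** [switch_flow] divided by [2 r n]. Above [t] the drift is at least [4 r n t], of which [ht] lets
    the bad quadruples destroy at most half. The window has width 4, a bound for the change of a cut
    in one switching, and inside it the cut is at most [mu + t + 4]. *)
Lemma ntail_step (t : R) : 0 < t -> 16 * m * r%:R ^+ 2 <= n%:R * t ->
  ntail t * t <= (ntail t - ntail (t + 4)) * (2 * (2 * mu + t + 4)).
Proof.
move=> t0 ht.
have flow : \sum_(E in G | t <= g E) \sum_(q | switchable E q) (g E - g (switch E q)) <=
    \sum_(E in G | t <= g E < t + 4) \sum_(q | switchable E q) `|g E - g (switch E q)|.
  by apply: switch_flow => E q EG sw; rewrite drop_norm.
have nmu : n%:R * mu = r%:R * (#|S|%:R * #|T|%:R) by rewrite /cut_mean; field; rewrite gt_eqF.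
move: flow; set L := \sum_(E in G | _) _; set U := \sum_(E in G | _) _ => LU.
have rn0 : 0 < 2 * r%:R * n%:R :> R by rewrite !mulr_gt0.
have hL : ntail t * (2 * r%:R * n%:R * t) <= L.
  rewrite /ntail -sum1_card natr_sum mulr_suml /L.
  rewrite [leLHS](eq_bigl (fun E => (E \in G) && (t <= g E))); last by move=> E; rewrite inE.
  apply: ler_sum => E /andP[EG tE]; rewrite mul1r.
  rewrite (eq_bigr (fun q => (-1) ^+ sg * cut_drop R S T q)); last by move=> q; apply: drop_eq.
  have EG' := EG; rewrite inE in EG'.
  rewrite -mulr_sumr; have := sum_switchable_drop EG' r0 Sm Tm.
  set D := \sum_(q | _) _; rewrite -nmu -mulrBr.
  move: tE; rewrite /deviation; set z := cutE R E S T - mu => tz hD.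
  have h1 : 4 * r%:R * n%:R * t <= 4 * r%:R * n%:R * ((-1) ^+ sg * z).
    by rewrite ler_pM2l // !mulr_gt0.
  have h2 : 32 * m * r%:R ^+ 3 <= 2 * r%:R * (n%:R * t).
    have -> : 32 * m * r%:R ^+ 3 = 2 * r%:R * (16 * m * r%:R ^+ 2) by ring.
    by rewrite ler_pM2l // mulr_gt0.
  have h3 : `|(-1) ^+ sg * D - 4 * r%:R * n%:R * ((-1) ^+ sg * z)| <= 32 * m * r%:R ^+ 3.
    rewrite (_ : _ - _ = (-1) ^+ sg * (D - 4 * r%:R * (n%:R * z))); last by ring.
    by rewrite normrMsign.
  by move: h3; rewrite ler_norml; lra.
have hU : U <= (ntail t - ntail (t + 4)) * (4 * r%:R * n%:R * (2 * mu + t + 4)).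
  rewrite -ntail_diff // -sum1_card natr_sum mulr_suml /U.
  rewrite [leRHS](eq_bigl (fun E => (E \in G) && (t <= g E < t + 4))); last first.
    by move=> E; rewrite inE.
  apply: ler_sum => E /andP[EG /andP[tE Et]]; rewrite mul1r.
  have EG' := EG; rewrite inE in EG'.
  apply: (@le_trans _ _ (\sum_(q | switchable E q) cut_variation R S T q)).
    by apply: ler_sum => q sw; rewrite drop_norm // norm_cut_drop.
  apply: le_trans (sum_switchable_variation R S T EG') _.
  rewrite -nmu -mulrDr [leLHS]mulrA ler_pM2l ?mulr_gt0 //.
  move: tE Et; rewrite /deviation; case: (sg) => /=; rewrite ?expr1 ?expr0; lra.
have := le_trans hL (le_trans LU hU).
rewrite (_ : _ * (2 * _ * _ * t) = 2 * r%:R * n%:R * (ntail t * t)); last by ring.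
rewrite (_ : _ * (4 * _ * _ * _) = 2 * r%:R * n%:R *
  ((ntail t - ntail (t + 4)) * (2 * (2 * mu + t + 4)))); last by ring.
by rewrite ler_pM2l.
Qed.

Lemma ntail_bound (D : R) : 16 <= D -> 32 * m * r%:R ^+ 2 <= n%:R * D ->
  ntail D <= expR (- (D ^+ 2 / (64 * (2 * mu + D)))) * #|G|%:R.
Proof.
move=> D16 hD.
(* Between [D / 2] and [D], every advance by 4 removes at least the proportion [rho] of the tail. *)
pose rho := D / (4 * (2 * mu + D)).
have mu0 : 0 <= mu by [].
have den0 : 0 < 2 * mu + D by lra.
have rho0 : 0 <= rho by rewrite divr_ge0 //; [lra | rewrite mulr_ge0 //; lra].
have rho1 : rho <= 1.
  by rewrite /rho ler_pdivrMr ?mulr_gt0 //; have := mu_ge0; have := den0; lra.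
have step t : D / 2 <= t -> t + 4 <= D -> ntail (t + 4) <= (1 - rho) * ntail t.
  move=> t1 t2; have t0 : 0 < t by lra.
  have ht : 16 * m * r%:R ^+ 2 <= n%:R * t.
    have : n%:R * D / 2 <= n%:R * t by rewrite -mulrA ler_pM2l.
    lra.
  have := ntail_step t0 ht; have := ntail_ge0 t; have := ntail_mono (_ : t <= t + 4).
  move=> /(_ _)h; have {h} := h (ltac:(by lra)).
  set a := ntail t; set b := ntail (t + 4) => ba a0 h.
  have h1 : a * (D / 2) <= a * t by apply: ler_wpM2l.
  have h2 : (a - b) * (2 * (2 * mu + t + 4)) <= (a - b) * (2 * (2 * mu + D)).
    by apply: ler_wpM2l; lra.
  have h3 : a * (D / 2) <= (a - b) * (2 * (2 * mu + D)) by lra.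
  have : a * rho <= a - b.
    rewrite /rho mulrA ler_pdivrMr; last by lra.
    lra.
  lra.
have pow k : D / 2 + 4 * k%:R <= D -> ntail (D / 2 + 4 * k%:R) <= (1 - rho) ^+ k * #|G|%:R.
  elim: k => [|k IH] hk; first by rewrite expr0 mul1r ntail_le.
  have kS : k.+1%:R = k%:R + 1 :> R by rewrite natr1.
  rewrite kS in hk *.
  have -> : D / 2 + 4 * (k%:R + 1) = D / 2 + 4 * k%:R + 4 by ring.
  have k0 : 0 <= k%:R :> R by [].
  have t1 : D / 2 <= D / 2 + 4 * k%:R by lra.
  have t2 : D / 2 + 4 * k%:R + 4 <= D by lra.
  apply: le_trans (step _ t1 t2) _.
  rewrite exprS -mulrA; apply: ler_wpM2l; first by lra.
  by apply: IH; lra.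
have D8 : 0 <= D / 8 by lra.
(* [D / 8] advances by 4 lead from [D / 2] to [D]; [16 <= D] makes their rounded number at least
   [D / 16]. *)
pose k := Num.truncn (D / 8).
have /andP[k1 k2] := truncn_itv D8; rewrite -/k in k1 k2.
have kS : k.+1%:R = k%:R + 1 :> R by rewrite natr1.
rewrite kS in k2.
have hk : D / 2 + 4 * k%:R <= D by lra.
apply: le_trans (ntail_mono hk) _; apply: le_trans (pow k hk) _.
apply: ler_wpM2r => //.
apply: (@le_trans _ _ (expR (- rho) ^+ k)).
  by apply: lerXn2r; rewrite ?nnegrE ?expR_ge0 //; [lra | exact: expR_ge1Dx].
have e : D ^+ 2 / (64 * (2 * mu + D)) = rho * (D / 16).
  by rewrite /rho; field; rewrite gt_eqF.
rewrite -expRM_natl ler_expR mulrN lerN2 (mulrC k%:R) e.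
by apply: ler_wpM2l => //; lra.
Qed.

End Tail.

(** * Discrepancy of small sets: tail against entropy *)

Section Levels.
Variable R : realType.

Lemma sum_expR_card (n : nat) (a : R) :
  \sum_(S : {set 'I_n}) expR (- a * #|S|%:R) = (1 + expR (- a)) ^+ n.
Proof.
rewrite addrC -[in RHS](card_ord n) -prodr_const.
rewrite [RHS](bigA_distr _ _ (fun=> expR (- a)) (fun=> 1)) /=.
apply: eq_bigr => S _; rewrite -big_mkcond /= prodr_const.
by rewrite mulrC expRM_natl.
Qed.

Lemma expR4_ge16 (t : nat) : 16 ^+ t <= expR (4 * t%:R) :> R.
Proof.
rewrite mulrC expRM_natl; apply: lerXn2r; rewrite ?nnegrE ?expR_ge0 //.
rewrite -(mulr1 (4 : R)) (expRM_natl 4) (_ : 16 = 2 ^+ 4); last by ring.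
by have := @expR_ge1Dx R 1; move=> h; apply: lerXn2r; rewrite ?nnegrE ?expR_ge0 //; lra.
Qed.

(** Chernoff's method: weigh S by [exp(a (Q - |S|))] with [a = 4 t], large enough that
    [n exp(-a) <= Q]. *)
Lemma card_small_sets (n t : nat) (Q : R) : n%:R = Q * 16 ^+ t ->
  #|[set S : {set 'I_n} | #|S|%:R <= Q]|%:R <= expR (Q * (4 * t%:R + 1)).
Proof.
move=> nQ; pose a : R := 4 * t%:R.
rewrite -sum1_card natr_sum.
apply: (@le_trans _ _ (\sum_(S : {set 'I_n}) expR (a * Q) * expR (- a * #|S|%:R))).
  rewrite big_mkcond; apply: ler_sum => S _; rewrite inE -expRD.
  case: ifP => [SQ|_]; last exact: expR_ge0.
  have : 0 <= a * (Q - #|S|%:R) by rewrite mulr_ge0 ?subr_ge0 // mulr_ge0.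
  have := @expR_ge1Dx R (a * Q + - a * #|S|%:R); lra.
rewrite -mulr_sumr sum_expR_card.
have -> : Q * (4 * t%:R + 1) = a * Q + Q by rewrite /a; ring.
rewrite expRD ler_pM2l ?expR_gt0 //.
apply: (@le_trans _ _ (expR (expR (- a)) ^+ n)).
  have h1 : 0 <= 1 + expR (- a) by rewrite addr_ge0 ?expR_ge0.
  by apply: lerXn2r; rewrite ?nnegrE ?expR_ge0 // expR_ge1Dx.
have Q0 : 0 <= Q by rewrite -(pmulr_lge0 _ (exprn_gt0 t (ltr0n R 16))) -nQ ler0n.
rewrite -expRM_natl ler_expR nQ expRN -mulrA ler_piMr // ler_pdivrMr ?expR_gt0 //.
by rewrite mul1r expR4_ge16.
Qed.


(* Locked: unification would otherwise evaluate 2 ^+ 14 in unary. *)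
Definition discrepancy_const : R := locked (2 ^+ 14).
Local Notation K := discrepancy_const.

Lemma discrepancy_constE : K = 128 * 128.
Proof. by rewrite /discrepancy_const -lock; ring. Qed.

Lemma discrepancy_const_ge1 : 1 <= K.
Proof. by rewrite discrepancy_constE; lra. Qed.

Lemma discrepancy_const_gt0 : 0 < K.
Proof. exact: lt_le_trans ltr01 discrepancy_const_ge1. Qed.

Definition level_ok (n r t : nat) (E : {set {set 'I_n}}) : Prop :=
  forall S T : {set 'I_n},
  #|S|%:R <= n%:R / 16 ^+ t :> R -> #|T|%:R <= n%:R / 16 ^+ t :> R ->
  `|cutE R E S T - cut_mean R r S T| <= K * Num.sqrt r%:R * (n%:R / 32 ^+ t).

(* The tail exponent at level t, with P = 2 ^ t, s = sqrt r and sets of size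
   at most nn / P ^ 4; it must beat the entropy 2 (4 t + 1) nn / P ^ 4 of the
   choice of the two sets. *)
Lemma level_exponent (nn s P mu D : R) : 1 <= s -> 1 <= P -> P ^+ 4 <= 16 * s ->
  0 < nn -> 0 <= mu -> mu <= s ^+ 2 / nn * (nn / P ^+ 4) ^+ 2 ->
  D = K * s * (nn / P ^+ 5) ->
  8 * (nn / P ^+ 4) * P <= D ^+ 2 / (64 * (2 * mu + D)).
Proof.
move=> s1 P1 Ps nn0 mu0 hmu DE.
have P0 : 0 < P by lra.
have s0 : 0 < s by lra.
have K0 := discrepancy_const_gt0.
have D0 : 0 < D by rewrite DE !mulr_gt0 ?invr_gt0 ?exprn_gt0.
rewrite ler_pdivlMr; last by lra.
have h1 : 2 * mu + D <= 2 * (s ^+ 2 / nn * (nn / P ^+ 4) ^+ 2) + D by lra.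
have c0 : 0 <= 8 * (nn / P ^+ 4) * P * 64.
  by rewrite !mulr_ge0 ?invr_ge0 ?exprn_ge0 // ltW.
have := ler_wpM2l c0 h1.
have e1 : 8 * (nn / P ^+ 4) * P * 64 * (2 * (s ^+ 2 / nn * (nn / P ^+ 4) ^+ 2) + D)
  = nn ^+ 2 / P ^+ 11 * (1024 * s ^+ 2 + 512 * K * s * P ^+ 3).
  by rewrite DE; field; rewrite !gt_eqF.
have e2 : D ^+ 2 = nn ^+ 2 / P ^+ 11 * (K ^+ 2 * s ^+ 2 * P).
  by rewrite DE; field; rewrite !gt_eqF.
rewrite e1 e2 => h; rewrite [leLHS]mulrA (le_trans h) //.
apply: ler_wpM2l; first by rewrite mulr_ge0 ?invr_ge0 ?exprn_ge0 // ltW.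
have P2 : P ^+ 2 <= P ^+ 4 by apply: ler_weXn2l.
have KK := discrepancy_constE.
(* This fixes the constant: [K = 1024 * 16] and [P^2 <= P^4 <= 16 s] give [1024 P^2 <= K s]. *)
have h2 : 512 * K * s * P ^+ 3 <= K ^+ 2 / 2 * s ^+ 2 * P.
  have -> : K ^+ 2 / 2 * s ^+ 2 * P = K / 2 * s * P * (K * s) by ring.
  have -> : 512 * K * s * P ^+ 3 = K / 2 * s * P * (1024 * P ^+ 2) by field.
  apply: ler_wpM2l; first by rewrite !mulr_ge0 ?invr_ge0 ?ltW.
  by rewrite KK; clear -P2 Ps; lra.
have h3 : 1024 * s ^+ 2 <= K ^+ 2 / 2 * s ^+ 2 * P.
  have s2 : 0 < s ^+ 2 by rewrite exprn_gt0.
  have : s ^+ 2 <= s ^+ 2 * P by rewrite ler_peMr // ltW.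
  by rewrite KK; clear -s2; lra.
clear -h2 h3; lra.
Qed.

(** Two choices of a set, the factor 2 for the two tails (absorbed in [exp(5 Q)]), and the tail
    itself, whose exponent [8 Q 2^t] is at least [8 Q (t + 1)]. *)
Lemma expR_budget (Q t : R) :
  expR (Q * (4 * t + 1)) * expR (Q * (4 * t + 1)) * expR (5 * Q)
    * expR (- (8 * Q * (t + 1))) = expR (- Q).
Proof. by rewrite -!expRD; congr expR; ring. Qed.

Lemma level_fail (n r t : nat) : (256 <= n)%N -> (0 < r)%N -> (r ^ 2 <= n)%N ->
  16 ^+ t <= 16 * Num.sqrt (r%:R : R) ->
  #|[set E in regular_graphs n r | ~~ `[< level_ok r t E >]]|%:R <=
    expR (- (n%:R / 16 ^+ t)) * #|regular_graphs n r|%:R :> R.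
Proof.
move=> n256 r0 rn tr.
set G := regular_graphs n r; set s := Num.sqrt (r%:R : R) in tr *.
pose P : R := 2 ^+ t; pose Q : R := n%:R / 16 ^+ t.
have n0 : (0 < n)%N by apply: leq_trans n256.
have nR : 0 < n%:R :> R by rewrite ltr0n.
have n256R : 256 <= n%:R :> R by rewrite (ler_nat R 256).
have s2 : s ^+ 2 = r%:R by rewrite sqr_sqrtr.
have s0 : 0 <= s by rewrite sqrtr_ge0.
have r1 : 1 <= r%:R :> R by rewrite ler1n.
have s1 : 1 <= s by rewrite -(ler_pXn2r (n := 2)) ?nnegrE // s2 expr1n.
have s4n : s ^+ 4 <= n%:R.
  have -> : s ^+ 4 = (s ^+ 2) ^+ 2 by ring.
  by rewrite s2 -natrX ler_nat.
have P1 : 1 <= P by rewrite exprn_ege1 // ler1n.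
have P0 : 0 < P by lra.
have e16 : 16 ^+ t = P ^+ 4 by rewrite -exprM mulnC exprM; congr (_ ^+ _); ring.
have e32 : 32 ^+ t = P ^+ 5 by rewrite -exprM mulnC exprM; congr (_ ^+ _); ring.
have PP : P <= P ^+ 4 by rewrite -[leLHS]expr1; apply: ler_weXn2l.
rewrite e16 in tr.
have sn : 16 * s <= n%:R.
  have [s16|s16] := leP s 16; first by lra.
  have a1 : 16 * s <= s ^+ 2 by rewrite expr2 ler_wpM2r // ltW.
  have a2 : s ^+ 2 <= s ^+ 4 by apply: ler_weXn2l.
  lra.
have Q1 : 1 <= Q by rewrite /Q e16 ler_pdivlMr ?exprn_gt0 // mul1r; lra.
pose D : R := K * s * (n%:R / P ^+ 5).
have KK := discrepancy_constE.
have P5 : P ^+ 5 <= 256 * s ^+ 2.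
  have -> : P ^+ 5 = P * P ^+ 4 by ring.
  have -> : 256 * s ^+ 2 = (16 * s) * (16 * s) by ring.
  by apply: ler_pM; rewrite ?exprn_ge0 ?(ltW P0) // (le_trans PP).
have s24 : s ^+ 2 <= s ^+ 4 by apply: ler_weXn2l.
have D16 : 16 <= D.
  rewrite /D mulrA ler_pdivlMr ?exprn_gt0 //.
  have sn1 : n%:R <= s * n%:R by rewrite ler_peMl // ltW.
  rewrite KK; clear -P5 s24 s4n sn1 nR; lra.
(* Through [s^4 <= n], the condition [r^2 <= n] keeps the bad quadruples from hiding the drift at
   distance [D] from the mean. *)
have hD : 32 * Q * r%:R ^+ 2 <= n%:R * D.
  have -> : 32 * Q * r%:R ^+ 2 = n%:R / P ^+ 5 * s * (32 * s ^+ 3 * P).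
    by rewrite -s2 /Q e16; field; rewrite gt_eqF.
  have -> : n%:R * D = n%:R / P ^+ 5 * s * (K * n%:R) by rewrite /D; ring.
  apply: ler_wpM2l; first by rewrite !mulr_ge0 ?invr_ge0 ?exprn_ge0 // ltW.
  have s3P : s ^+ 3 * P <= s ^+ 3 * (16 * s).
    by apply: ler_wpM2l; rewrite ?exprn_ge0 // (le_trans PP).
  have e34 : s ^+ 3 * (16 * s) = 16 * s ^+ 4 by ring.
  rewrite KK; clear -s3P e34 s4n nR; lra.
pose small := [set S : {set 'I_n} | #|S|%:R <= Q].
have tail (S T : {set 'I_n}) sg : S \in small -> T \in small ->
    ntail r S T sg D <= expR (- (8 * Q * (t%:R + 1))) * #|G|%:R.
  rewrite !inE => SQ TQ.
  apply: le_trans (ntail_bound sg n0 r0 SQ TQ D16 hD) _.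
  apply: ler_wpM2r => //; rewrite ler_expR lerN2.
  have mu0 : 0 <= cut_mean R r S T by rewrite /cut_mean !mulr_ge0 ?invr_ge0.
  have mu1 : cut_mean R r S T <= s ^+ 2 / n%:R * (n%:R / P ^+ 4) ^+ 2.
    rewrite /cut_mean s2; apply: ler_wpM2l; first by rewrite divr_ge0.
    by rewrite expr2 -e16; apply: ler_pM.
  have := level_exponent s1 P1 tr nR mu0 mu1 (erefl D).
  rewrite -/D -e16 -/Q; apply: le_trans; apply: ler_wpM2l; first by clear -Q1; lra.
  by rewrite /P natr1 -natrX ler_nat ltn_expl.
pose hit (S T : {set 'I_n}) sg E : R := (D <= deviation R r S T sg E)%R%:R.
have hit0 S T sg E : 0 <= hit S T sg E by exact: ler0n.
have nQ : n%:R = Q * 16 ^+ t by rewrite /Q divfK // e16 gt_eqF // exprn_gt0.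
have bad_le E : E \in G -> (~~ `[< level_ok r t E >])%:R <=
    \sum_(S in small) \sum_(T in small) \sum_(sg : bool) hit S T sg E :> R.
  move=> EG; have [ok|nok] := boolP `[< level_ok r t E >].
    by apply: sumr_ge0 => S _; apply: sumr_ge0 => T _; apply: sumr_ge0.
  have [S [T [Ss Ts hST]]] : exists S T, [/\ S \in small, T \in small &
      D <= `|cutE R E S T - cut_mean R r S T|].
    apply: contrapT => h; move/asboolP: nok; apply => S T hS hT.
    rewrite leNgt; apply/negP => hlt; apply: h; exists S, T.
    by rewrite !inE; split => //; rewrite /D -e32 ltW.
  have nn1 (F : {set 'I_n} -> R) (U : {set 'I_n}) : (forall V, 0 <= F V) -> U \in small ->
      F U <= \sum_(V in small) F V.
    by move=> F0 Us; rewrite (bigD1 U) //= lerDl; apply: sumr_ge0.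
  apply: (@le_trans _ _ (\sum_(sg : bool) hit S T sg E)).
    rewrite big_bool /hit /deviation /= expr1 expr0 mulN1r mul1r.
    move: hST; rewrite ler_normr => /orP[->|->]; first by rewrite lerDr.
    by rewrite lerDl.
  apply: le_trans (nn1 (fun S => \sum_(T in small) \sum_(sg : bool)
    hit S T sg E) S _ Ss).
    apply: (nn1 (fun T => \sum_(sg : bool) hit S T sg E)) => // V.
    exact: sumr_ge0.
  by move=> V; apply: sumr_ge0 => W _; apply: sumr_ge0.
rewrite -/Q -sum1_card natr_sum.
rewrite (eq_bigl (fun E => (E \in G) && ~~ `[< level_ok r t E >])); last first.
  by move=> E; rewrite inE.
rewrite big_mkcondr /=.
apply: (@le_trans _ _ (\sum_(E in G) \sum_(S in small) \sum_(T in small) \sum_(sg : bool)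
   hit S T sg E)).
  by apply: ler_sum => E EG; apply: le_trans (bad_le E EG); case: (~~ _).
rewrite exchange_big /=.
apply: (@le_trans _ _ (\sum_(S in small) \sum_(T in small)
   2 * (expR (- (8 * Q * (t%:R + 1))) * #|G|%:R))).
  apply: ler_sum => S Ss; rewrite exchange_big /=; apply: ler_sum => T Ts.
  rewrite exchange_big /= big_bool /= mulr_natl mulr2n.
  have cnt sg : \sum_(E in G) hit S T sg E = ntail r S T sg D.
    rewrite /ntail /hit -sum1_card natr_sum.
    rewrite [RHS](eq_bigl (fun E => (E \in G) && (D <= deviation R r S T sg E))).
      by rewrite [RHS]big_mkcondr; apply: eq_bigr => E _; case: ifP.
    by move=> E; rewrite inE.
  by rewrite !cnt; apply: lerD; apply: tail.
have hc := card_small_sets nQ; rewrite -/small in hc.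
set N : R := #|small|%:R in hc.
have constE (c : R) : \sum_(S in small) c = N * c by rewrite sumr_const /N mulr_natl.
under eq_bigr do rewrite constE.
rewrite constE 3!mulrA ler_wpM2r //.
have N2 : N * N <= expR (Q * (4 * t%:R + 1)) * expR (Q * (4 * t%:R + 1)) by apply: ler_pM.
have e2 : 2 <= expR (5 * Q) by have := @expR_ge1Dx R (5 * Q); clear -Q1; lra.
have e0 : 0 <= expR (- (8 * Q * (t%:R + 1))) by apply: expR_ge0.
apply: (@le_trans _ _ (expR (Q * (4 * t%:R + 1)) * expR (Q * (4 * t%:R + 1))
   * expR (5 * Q) * expR (- (8 * Q * (t%:R + 1))))).
  apply: ler_wpM2r => //; apply: ler_pM => //; rewrite mulr_ge0 //.
by rewrite expR_budget.
Qed.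

End Levels.

(** * Existence of regular graphs *)

Section Circulant.

Lemma regular_of_rel (n r : nat) (e : rel 'I_n) :
  symmetric e -> irreflexive e -> (forall i, #|[set j | e i j]| = r) ->
  is_regular_graph r [set edge p.1 p.2 | p in [set p : 'I_n * 'I_n | e p.1 p.2]]%SET.
Proof.
move=> es ei er; apply/andP; split.
  apply/forallP => f; apply/implyP => /imsetP[[x y]]; rewrite inE /= => exy ->.
  by rewrite card_edge //; apply: contraTneq exy => ->; rewrite ei.
apply/forallP => i; rewrite -(er i).
rewrite (_ : [set _ in _ | _] = [set edge i j | j in [set j | e i j]]%SET).
  rewrite card_in_imset // => j k; rewrite !inE => eij eik /edge_eq[[]//|[hk hj]].
  by rewrite hj -hk.
apply/setP => f; rewrite inE; apply/andP/imsetP => [[/imsetP[[x y]]]|[j]].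
  rewrite inE /= => exy -> ; rewrite in_edge => /orP[/eqP->|/eqP->].
    by exists y; rewrite ?inE.
  by exists x; rewrite ?inE 1?es // edgeC.
rewrite inE => eij ->; rewrite in_edge eqxx; split=> //.
by apply/imsetP; exists (i, j); rewrite ?inE.
Qed.

Lemma card_ord_range (n a b : nat) : (b <= n)%N ->
  #|[set d : 'I_n | (a <= d < b)%N]| = (b - a)%N.
Proof.
move=> bn; rewrite cardsE -sum1_card.
rewrite -[RHS]muln1 -sum_nat_const_nat.
rewrite (big_nat_widen _ _ n) // big_geq_mkord /=.
by apply: eq_bigl => d; rewrite andbC.
Qed.

(** A circulant graph on Z/n: differences up to r/2 in absolute value, together with n/2 when r is
    odd, n being even then. It keeps the denominator of [prob_Gnr] from vanishing. *)
Lemma regular_graph_exists (n r : nat) : (r < n)%N -> ~~ odd (r * n) ->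
  (0 < #|regular_graphs n r|)%N.
Proof.
case: n => [//|n'] rn ev; have [n nE] : exists n, n = n'.+1 by exists n'.+1.
have [h hE] : exists h, h = r./2 by exists r./2.
have r2h : r = (odd r + h.*2)%N by rewrite hE odd_double_half.
rewrite -nE in rn ev.
pose P (d : nat) := (0 < d)%N && [|| (d <= h)%N, (n - h <= d)%N | odd r && (d.*2 == n)].
pose D := [set d : 'I_n'.+1 | P d].
have nh : (h < n - h)%N by lia.
have hodd : odd r -> ~~ odd n by move=> hr; move: ev; rewrite oddM hr.
have PN (d : 'I_n'.+1) : P (- d)%R = P d.
  rewrite /P /=; have := ltn_ord d; case: (posnP d) => [->|d0 dn].
    by rewrite subn0 modnn.
  rewrite modn_small; last by lia.
  apply/idP/idP; lia.
have cD : #|D| = r.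
  pose D1 := [set d : 'I_n'.+1 | (1 <= d < h.+1)%N].
  pose D2 := [set d : 'I_n'.+1 | (n - h <= d < n)%N].
  pose D3 := [set d : 'I_n'.+1 | (n./2 <= d < n./2 + odd r)%N].
  have DE : D = (D1 :|: (D2 :|: D3))%SET.
    apply/setP => d; rewrite !inE /P; have := ltn_ord d.
    case hr: (odd r) => /=; last by lia.
    have := hodd hr; lia.
  rewrite DE cardsU cardsU !card_ord_range; try (case hr : (odd r) => //=; lia).
  rewrite (_ : (D2 :&: D3)%SET = finset.set0); last first.
    apply/setP => d; rewrite !inE.
    case hr: (odd r) => /=; last by lia.
    have := hodd hr; lia.
  rewrite (_ : (D1 :&: _)%SET = finset.set0); last first.
    apply/setP => d; rewrite !inE.
    case hr: (odd r) => /=; last by lia.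
    have := hodd hr; lia.
  rewrite !cards0; case hr: (odd r) => /=; lia.
apply/card_gt0P; eexists; rewrite inE.
apply: (@regular_of_rel n'.+1 r (fun i j => j - i \in D)).
- by move=> i j; rewrite !inE -PN opprB.
- by move=> i; rewrite inE subrr /P.
- move=> i; rewrite -cD -[RHS](card_imset _ (addrI i)).
  apply: eq_card => j; rewrite inE; apply/idP/imsetP => [jD|[d dD ->]].
    by exists (j - i) => //; rewrite addrC subrK.
  by rewrite addrC addKr.
Qed.

End Circulant.

(** * Positive semidefinite matrices and semidefinite duality *)

Section PSD.
Variables (R : realType) (n : nat).
Implicit Types (P V : 'M[R]_n) (x y : 'rV[R]_n).

Definition qform P x : R := (x *m P *m x^T) 0 0.

Definition psd P := P^T = P /\ forall x, 0 <= qform P x.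

Lemma qformE P x : qform P x = \sum_i \sum_j P i j * (x 0 i * x 0 j).
Proof.
rewrite /qform mxE exchange_big /=; apply: eq_bigr => j _.
rewrite !mxE mulr_suml; apply: eq_bigr => i _; rewrite ?mxE; ring.
Qed.

Lemma qformB P P' x : qform (P - P') x = qform P x - qform P' x.
Proof. by rewrite /qform mulmxBr mulmxBl !mxE. Qed.

Lemma qform_gram (m : nat) (V : 'M[R]_(n, m)) x :
  qform (V *m V^T) x = \sum_k (x *m V) 0 k ^+ 2.
Proof.
rewrite /qform mulmxA -mulmxA -trmx_mul mxE; apply: eq_bigr => k _.
by rewrite [X in _ * X]mxE expr2.
Qed.

Lemma psd_gram (m : nat) (V : 'M[R]_(n, m)) : psd (V *m V^T).
Proof.
split=> [|x]; first by rewrite trmx_mul trmxK.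
by rewrite qform_gram; apply: sumr_ge0 => k _; rewrite sqr_ge0.
Qed.

Lemma psdD P P' : psd P -> psd P' -> psd (P + P').
Proof.
move=> [sP pP] [sP' pP']; split; first by rewrite linearD /= sP sP'.
by move=> x; rewrite /qform mulmxDr mulmxDl mxE addr_ge0 //; [exact: pP | exact: pP'].
Qed.

Lemma psdZ (a : R) P : 0 <= a -> psd P -> psd (a *: P).
Proof.
move=> a0 [sP pP]; split; first by rewrite linearZ /= sP.
by move=> x; rewrite /qform -scalemxAr -scalemxAl mxE mulr_ge0 //; exact: pP.
Qed.

Lemma qform_shift P x (i : 'I_n) (c : R) : P^T = P ->
  qform P (x + c *: delta_mx 0 i) = qform P x + 2 * c * (x *m P) 0 i + c ^+ 2 * P i i.
Proof.
move=> sP; pose d : 'rV[R]_n := delta_mx 0 i.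
have e1 : (x *m P *m d^T) 0 0 = (x *m P) 0 i.
  by rewrite /d trmx_delta -colE mxE.
have e2 : (d *m P *m x^T) 0 0 = (x *m P) 0 i.
  rewrite -e1 -[RHS](_ : ((x *m P *m d^T)^T) 0 0 = _); last by rewrite mxE.
  by rewrite !trmx_mul trmxK sP mulmxA.
have e3 : (d *m P *m d^T) 0 0 = P i i.
  by rewrite /d trmx_delta -colE -rowE !mxE.
rewrite -/d /qform linearD linearZ /= !mulmxDl !mulmxDr -!scalemxAl -!scalemxAr.
move: e1 e2 e3; set A0 := x *m P *m x^T; set A1 := x *m P *m d^T.
set A2 := d *m P *m x^T; set A3 := d *m P *m d^T => e1 e2 e3.
have eD (X Y : 'M[R]_1) : (X + Y) 0 0 = X 0 0 + Y 0 0 by rewrite mxE.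
have eZ (X : 'M[R]_1) : (c *: X) 0 0 = c * X 0 0 by rewrite mxE.
rewrite !eD !eZ e2 e3 e1; ring.
Qed.

Lemma psd_diag P i : psd P -> 0 <= P i i.
Proof.
move=> [sP pP]; have := pP (0 + 1 *: delta_mx 0 i); rewrite qform_shift //.
by rewrite /qform !mul0mx !mxE mulr0 !add0r expr1n mul1r.
Qed.

Lemma psd_diag0 P i j : psd P -> P i i = 0 -> P j i = 0.
Proof.
move=> psdP Pii; have [sP pP] := psdP; apply/eqP/negP => /negP Pji.
(* The coefficient is chosen to give the form the value -1. *)
have := pP (delta_mx 0 j + (- (P j j + 1) / (2 * P j i)) *: delta_mx 0 i).
rewrite qform_shift // Pii mulr0 addr0 -rowE mxE.
have := qform_shift 0 j 1 sP; rewrite add0r scale1r => ->.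
rewrite /qform !mul0mx !mxE mulr0 !add0r expr1n mul1r.
rewrite (_ : 2 * _ * _ = - (P j j + 1)); last by field; rewrite Pji.
lra.
Qed.

(** The new form at [x] is the form of [P] minimised over the i-th coordinate, hence still
    nonnegative. *)
Lemma psd_schur P i : psd P -> 0 < P i i ->
  psd (P - (P i i)^-1 *: (col i P *m (col i P)^T)).
Proof.
move=> [sP pP] a0; split.
  by rewrite linearB linearZ /= trmx_mul trmxK sP.
move=> x; set a := P i i in a0 *; set p := (x *m P) 0 i.
rewrite qformB (_ : qform (_ *: _) x = a^-1 * p ^+ 2); last first.
  rewrite /qform -scalemxAr -scalemxAl mxE; congr (_ * _).
  rewrite -/(qform _ x) qform_gram big_ord_recl big_ord0 addr0; congr (_ ^+ 2).
  by rewrite colE mulmxA -colE mxE.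
have := pP (x + (- p / a) *: delta_mx 0 i); rewrite qform_shift // -/p -/a.
congr (_ <= _); field; by rewrite gt_eqF.
Qed.

(** Cholesky elimination over a shrinking support [S]. Columns of V outside the support vanish, so
    column [i] is free for the new vector and V stays square: its rows lie in R^n, as vector
    colorings require. *)
Theorem psd_factor P : psd P -> exists V, P = V *m V^T.
Proof.
suff main k : forall P (S : {set 'I_n}), #|S| = k -> psd P ->
    (forall i j, i \notin S -> P i j = 0) ->
    exists V, P = V *m V^T /\ forall i, i \notin S -> col i V = 0.
  move=> psdP; have [] := main #|[set: 'I_n]%SET| P [set: 'I_n]%SET erefl psdP.
    by move=> i j; rewrite inE.
  by move=> V [-> _]; exists V.
elim: k => [|k IH] {}P S.
  move=> /eqP; rewrite cards_eq0 => /eqP -> _ P0; exists 0; split.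
    by rewrite mul0mx; apply/matrixP => i j; rewrite P0 ?inE // mxE.
  by move=> i _; apply/matrixP => ? ?; rewrite !mxE.
move=> cS psdP P0; have [sP pP] := psdP.
have /card_gt0P[i iS] : (0 < #|S|)%N by rewrite cS.
have cS' : #|(S :\ i)%SET| = k by move: cS; rewrite (cardsD1 i) iS => -[].
pose a := P i i.
have symP j l : P j l = P l j by rewrite -[in LHS]sP mxE.
have [a0|a0] : a = 0 \/ 0 < a.
  by have := psd_diag i psdP; rewrite -/a le_eqVlt => /orP[/eqP <-|]; [left|right].
- have [|V [PV V0]] := IH P (S :\ i)%SET cS' psdP.
    move=> j l; rewrite !inE negb_and negbK => /orP[/eqP->|]; last exact: P0.
    by rewrite symP; apply: psd_diag0.
  by exists V; split=> // j jS; apply: V0; rewrite !inE (negPf jS) andbF.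
- pose p := col i P.
  have [|V [PV V0]] := IH _ (S :\ i)%SET cS' (psd_schur psdP a0).
    move=> j l; rewrite !inE negb_and negbK !mxE big_ord_recl big_ord0 !mxE addr0.
    case/orP=> [/eqP->|jS]; last by rewrite (P0 j l) // (P0 j i) // mul0r mulr0 subr0.
    by rewrite (symP l i) -/a; field; rewrite gt_eqF.
  pose s := Num.sqrt a^-1.
  have ss : s * s = a^-1 by rewrite -expr2 sqr_sqrtr // invr_ge0 ltW.
  exists (V + s *: (p *m delta_mx 0 i)); split.
    rewrite linearD linearZ /= trmx_mul mulmxDl !mulmxDr -!scalemxAl -!scalemxAr.
    rewrite trmx_delta.
    have VD : V *m delta_mx i (0 : 'I_1) = 0.
      by rewrite -colE; apply: V0; rewrite !inE eqxx.
    have DV : delta_mx (0 : 'I_1) i *m V^T = 0.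
      by rewrite -trmx_delta -trmx_mul VD trmx0.
    rewrite !mulmxA VD mul0mx scaler0 addr0 -[p *m _ *m V^T]mulmxA DV mulmx0 scaler0 add0r.
    rewrite -PV scalerA ss -[p *m _ *m _]mulmxA mul_delta_mx.
    rewrite (_ : delta_mx 0 0 = 1%:M) ?mulmx1 -/p -/a ?subrK //.
    by apply/matrixP => u v; rewrite !mxE !ord1.
  move=> j jS; rewrite linearD /= V0 ?inE ?(negPf jS) ?andbF // add0r linearZ /=.
  have ij : (j == i) = false by apply: contraNF jS => /eqP->.
  apply/matrixP => u v; rewrite !mxE big1 ?mulr0 // => w _; rewrite !mxE.
  by rewrite ij andbF mulr0.
Qed.

End PSD.

Section ContinuousOperations.
Variables (R : realType) (T : topologicalType).
Implicit Types f g : T -> R.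

Lemma continuous_subr f g :
  continuous f -> continuous g -> continuous (fun x => f x - g x).
Proof. by move=> cf cg x; apply: cvgB; [exact: cf | exact: cg]. Qed.

Lemma continuous_mulr f g :
  continuous f -> continuous g -> continuous (fun x => f x * g x).
Proof. by move=> cf cg x; apply: cvgM; [exact: cf | exact: cg]. Qed.

Lemma continuous_maxr f g :
  continuous f -> continuous g -> continuous (fun x => Num.max (f x) (g x)).
Proof. by move=> cf cg x; apply: continuous_max; [exact: cf | exact: cg]. Qed.

Lemma continuous_bigsum (I : Type) (s : seq I) (F : I -> T -> R) :
  (forall i, continuous (F i)) -> continuous (fun x => \sum_(i <- s) F i x).
Proof.
move=> cF x; elim: s => [|i s IH].
  by under eq_fun do rewrite big_nil; exact: cvg_cst.
by under eq_fun do rewrite big_cons; apply: cvgD; [exact: cF | exact: IH].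
Qed.

End ContinuousOperations.

Section Duality.
Variables (R : realType) (n : nat) (e : rel 'I_n) (kappa : R).
Hypotheses (e_sym : symmetric e) (e_irr : irreflexive e).
Implicit Types (P V W : 'M[R]_n).

Definition gap P (i j : 'I_n) : R := kappa * (i == j)%:R - 1 - P i j.

(** What remains of [kappa I - J + B - P] for the best [B] that is nonnegative on [e] and zero
    elsewhere; [dist2] is thus a squared distance to a cone. *)
Definition residual P (i j : 'I_n) : R :=
  if e i j then Num.max 0 (gap P i j) else gap P i j.

Definition dist2 P : R := \sum_i \sum_j residual P i j ^+ 2.

Let vec_gram (v : 'rV[R]_(n * n)) : 'M[R]_n := vec_mx v *m (vec_mx v)^T.

Let dist2_continuous : continuous (dist2 \o vec_gram).
Proof.
suff cterm i j : continuous (fun v => residual (vec_gram v) i j ^+ 2).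
  pose f i v := \sum_j residual (vec_gram v) i j ^+ 2.
  have cf i : continuous (f i) by apply: (continuous_bigsum (cterm i)).
  exact: (continuous_bigsum cf).
have cgap : continuous (fun v => gap (vec_gram v) i j).
  apply: continuous_subr; first exact: cst_continuous.
  have cF k : continuous (fun v : 'rV[R]_(n * n) => vec_mx v i k * (vec_mx v)^T k j).
    apply: continuous_mulr; under eq_fun do rewrite !mxE; exact: coord_continuous.
  under eq_fun do rewrite mxE; exact: (continuous_bigsum cF).
have cres : continuous (fun v => residual (vec_gram v) i j).
  rewrite /residual; case: (e i j) => //.
  by apply: continuous_maxr => //; exact: cst_continuous.
by under eq_fun do rewrite expr2; exact: continuous_mulr.
Qed.

(** Minimising over factors V instead of P makes semidefiniteness automatic. A minimum exists by
    coercivity: a large entry in row [i] makes [P i i] large, and diagonal residuals are not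
    truncated since [e] is irreflexive. *)
Lemma dist2_minimizer : exists V, forall W, dist2 (V *m V^T) <= dist2 (W *m W^T).
Proof.
pose d0 := dist2 ((0 : 'M[R]_n) *m (0 : 'M[R]_n)^T).
have d00 : 0 <= d0 by apply: sumr_ge0 => i _; apply: sumr_ge0 => j _; rewrite sqr_ge0.
pose L := `|kappa| + 2 + d0.
have L1 : 1 <= L by have := normr_ge0 kappa; rewrite /L; lra.
pose box := [set v : 'rV[R]_(n * n) | forall i, `[- L, L]%classic (v ord0 i)]%classic.
have box0 : box 0 by move=> i; rewrite /= mxE in_itv /=; apply/andP; split; lra.
have cbox : compact box by exact: (@rV_compact _ _ (fun=> `[- L, L]%classic) (fun i => @segment_compact _ _ _)).
have [v vbox vmin] : exists2 c, c \in box &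
    forall t, t \in box -> (dist2 \o vec_gram) c <= (dist2 \o vec_gram) t.
  apply: compact_EVT_min => //; first by exists 0.
  exact: continuous_subspaceT.
exists (vec_mx v) => W.
have dv0 : dist2 (vec_gram v) <= d0.
  have := vmin 0 (mem_set box0); rewrite /= /vec_gram /d0.
  by rewrite (linear0 vec_mx).
have [inbox|] := pselect (box (mxvec W)).
  by have := vmin _ (mem_set inbox); rewrite /= /vec_gram mxvecK.
move=> /existsNP[l]; case/mxvec_indexP: l => i k hik.
apply: le_trans dv0 _.
set P := W *m W^T.
have Wik : L ^+ 2 <= W i k ^+ 2.
  rewrite -[W i k ^+ 2]real_normK ?num_real //.
  have : L <= `|W i k|.
    rewrite leNgt; apply/negP => /ltW; rewrite ler_norml => h; apply: hik.
    by rewrite /= mxvecE in_itv.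
  by move=> h; apply: lerXn2r; rewrite ?nnegrE //; lra.
have Pii : L ^+ 2 <= P i i.
  apply: le_trans Wik _; rewrite /P mxE (bigD1 k) //= mxE -expr2 lerDl.
  by apply: sumr_ge0 => l _; rewrite mxE -expr2 sqr_ge0.
have LL : L <= L ^+ 2 by rewrite expr2 ler_peMr //; lra.
have hg : (1 + d0) ^+ 2 <= residual P i i ^+ 2.
  rewrite /residual e_irr /gap eqxx mulr1 -[leRHS]sqrrN.
  have := ler_norm kappa => hk.
  have LP : L <= P i i by lra.
  by rewrite /L in LP; apply: lerXn2r; rewrite ?nnegrE; lra.
have : d0 <= (1 + d0) ^+ 2 by have := sqr_ge0 d0; lra.
move=> h; apply: le_trans (le_trans h hg) _.
rewrite /dist2 (bigD1 i) //= (bigD1 i) //= -addrA lerDl addr_ge0 //.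
  by apply: sumr_ge0 => j _; rewrite sqr_ge0.
by apply: sumr_ge0 => a _; apply: sumr_ge0 => j _; rewrite sqr_ge0.
Qed.

(** First-order optimality. Steps stop at [s = 1] because the direction [-P] is also tested, where
    [P - s P] is sure to be semidefinite only that far. *)
Lemma linear_le_quadratic (a b : R) :
  (forall s, 0 < s <= 1 -> 2 * s * a <= s ^+ 2 * b) -> a <= 0.
Proof.
move=> h; rewrite leNgt; apply/negP => a0.
have b0 : 0 < b by have := h 1; rewrite ltr01 lexx => /(_ isT); lra.
have ab0 : 0 < a + b by lra.
pose s := a / (a + b).
have s0 : 0 < s by rewrite divr_gt0.
have s1 : s <= 1 by rewrite ler_pdivrMr // mul1r; lra.
have := h s; rewrite s0 s1 => /(_ isT).
have -> : 2 * s * a = s * (2 * a) by ring.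
rewrite expr2 -mulrA ler_pM2l //.
have : s * b <= a by rewrite /s mulrAC ler_pdivrMr // ler_pM2l //; lra.
lra.
Qed.

Let inner (A B : 'I_n -> 'I_n -> R) : R := \sum_i \sum_j A i j * B i j.

(** The [B] that is best for [P] stays admissible for [P + Q]; the best one there can only do
    better. *)
Let residual_shift P (Q : 'M[R]_n) i j :
  residual (P + Q) i j ^+ 2 <= (residual P i j - Q i j) ^+ 2.
Proof.
rewrite /residual; have -> : gap (P + Q) i j = gap P i j - Q i j.
  by rewrite /gap mxE; ring.
case: (e i j) => //; set g := gap P i j; set d := Q i j.
case: (leP 0 g) => g0; case: (leP 0 (g - d)) => gd; rewrite ?expr0n /= ?sqr_ge0 //.
by rewrite sub0r; apply: lerXn2r; rewrite ?nnegrE; lra.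
Qed.

Hypothesis dual_bound : forall W : 'M[R]_n,
  (forall i j, e i j -> (W *m W^T) i j <= 0) ->
  \sum_i \sum_j (W *m W^T) i j <= kappa * \tr (W *m W^T).

(* The residual of the projection of kappa I - J onto {psd - nonnegative on
   edges} is, up to sign, feasible for the dual problem, hence zero. *)
Theorem sdp_duality : exists B : 'M[R]_n,
  [/\ forall i j, e i j -> 0 <= B i j,
      forall i j, ~~ e i j -> B i j = 0 &
      psd (kappa%:M - const_mx 1 + B)].
Proof.
have [P psdP Pmin] : exists2 P, psd P & forall W, dist2 P <= dist2 (W *m W^T).
  by have [V Vmin] := dist2_minimizer; exists (V *m V^T) => //; exact: psd_gram.
pose D := residual P.
have opt (Q : 'M[R]_n) : (forall s, 0 < s <= 1 -> psd (P + s *: Q)) -> inner D Q <= 0.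
  move=> hQ; apply: (@linear_le_quadratic _ (inner Q Q)) => s s01.
  have [W PW] := psd_factor (hQ s s01).
  have := Pmin W; rewrite -PW /dist2 => h.
  have : \sum_i \sum_j residual P i j ^+ 2 <=
      \sum_i \sum_j (residual P i j - s * Q i j) ^+ 2.
    apply: le_trans h _; apply: ler_sum => i _; apply: ler_sum => j _.
    by apply: le_trans (residual_shift _ _ _ _) _; rewrite mxE.
  have -> : \sum_i \sum_j (residual P i j - s * Q i j) ^+ 2 =
     \sum_i \sum_j residual P i j ^+ 2 - 2 * s * inner D Q + s ^+ 2 * inner Q Q.
    rewrite /inner !mulr_sumr -sumrB -big_split; apply: eq_bigr => i _ /=.
    rewrite !mulr_sumr -sumrB -big_split; apply: eq_bigr => j _ /=.
    by rewrite /D; ring.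
  lra.
(* Both [P] and [-P] are admissible directions, so optimality becomes orthogonality. *)
have DP0 : inner D P = 0.
  apply/eqP; rewrite eq_le; apply/andP; split.
    apply: opt => s /andP[s0 _].
    by apply: psdD => //; apply: psdZ => //; exact: ltW.
  have : inner D (- P) <= 0.
    apply: opt => s /andP[_ s1].
    rewrite scalerN -{1}[P]scale1r -scalerBl; apply: psdZ => //; lra.
  rewrite /inner; under eq_bigr do under eq_bigr do rewrite mxE mulrN.
  under eq_bigr do rewrite sumrN; rewrite sumrN; lra.
have symP i j : P i j = P j i by have [s _] := psdP; rewrite -[in LHS]s mxE.
have symgap i j : gap P i j = gap P j i by rewrite /gap symP eq_sym.
have symD i j : D i j = D j i by rewrite /D /residual e_sym symgap.
(* Testing rank one directions shows [-D] semidefinite, and truncation makes it nonpositive on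
   edges, so its factor is allowed in [dual_bound]. *)
pose Z : 'M[R]_n := \matrix_(i, j) - D i j.
have psdZ' : psd Z.
  split; first by apply/matrixP => i j; rewrite !mxE symD.
  move=> x; have : inner D (x^T *m x) <= 0.
    apply: opt => s /andP[s0 _]; apply: psdD => //; apply: psdZ; first exact: ltW.
    by have := psd_gram x^T; rewrite trmxK.
  rewrite qformE /inner => h; rewrite -oppr_le0 -sumrN; apply: le_trans h.
  rewrite le_eqVlt; apply/orP; left; apply/eqP; apply: eq_bigr => i _.
  rewrite -sumrN; apply: eq_bigr => j _.
  by rewrite !mxE big_ord_recl big_ord0 !mxE addr0; ring.
have [W ZW] := psd_factor psdZ'.
have : \sum_i \sum_j Z i j <= kappa * \tr Z.
  rewrite {1 2}ZW; apply: dual_bound => i j eij; rewrite -ZW mxE /D /residual eij.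
  by rewrite oppr_le0 le_max lexx.
have -> : \tr Z = - \sum_i D i i.
  by rewrite /mxtrace -sumrN; apply: eq_bigr => i _; rewrite mxE.
have -> : \sum_i \sum_j Z i j = - \sum_i \sum_j D i j.
  rewrite -sumrN; apply: eq_bigr => i _; rewrite -sumrN; apply: eq_bigr => j _.
  by rewrite mxE.
move=> dual.
have DD : inner D D = 0.
  apply/eqP; rewrite eq_le; apply/andP; split; last first.
    by apply: sumr_ge0 => i _; apply: sumr_ge0 => j _; rewrite -expr2 sqr_ge0.
  (* Truncated entries of [D] vanish, so one factor [D] may be replaced by [gap]; the dual bound for
     [Z] then makes the value nonpositive. *)
  have -> : inner D D = kappa * \sum_i D i i - \sum_i \sum_j D i j - inner D P.
    rewrite /inner mulr_sumr -!sumrB; apply: eq_bigr => i _.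
    have -> : kappa * D i i = \sum_j kappa * (i == j)%:R * D i j.
      rewrite (bigD1 i) //= eqxx mulr1 big1 ?addr0 // => j /negPf ji.
      by rewrite eq_sym ji mulr0 mul0r.
    rewrite -!sumrB; apply: eq_bigr => j _.
    have -> : D i j * D i j = D i j * gap P i j.
      rewrite /D /residual; case: (e i j) => //.
      by case: (leP 0 (gap P i j)) => //; rewrite !mul0r.
    by rewrite /gap; ring.
  rewrite DP0; lra.
have D0 i j : D i j = 0.
  have nn k : 0 <= \sum_l D k l * D k l by apply: sumr_ge0 => l _; rewrite -expr2 sqr_ge0.
  have /eqP := DD; rewrite /inner psumr_eq0 // => /allP/(_ i).
  rewrite mem_index_enum /= => /(_ isT); rewrite psumr_eq0; last first.
    by move=> l _; rewrite -expr2 sqr_ge0.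
  move=> /allP/(_ j); rewrite mem_index_enum /= => /(_ isT).
  by rewrite mulf_eq0 orbb => /eqP.
exists (P - kappa%:M + const_mx 1); split.
- move=> i j eij; have := D0 i j; rewrite /D /residual eij !mxE => h.
  have : gap P i j <= 0 by rewrite -h le_max lexx orbT.
  by rewrite /gap -mulr_natr; lra.
- move=> i j eij; have := D0 i j; rewrite /D /residual (negPf eij) !mxE /gap -mulr_natr; lra.
- by rewrite addrACA addNr addr0 addrCA subrr addr0.
Qed.

End Duality.

(** * Vector colorings *)

Section ThetaOrder.
Variables (R : realType) (n : nat).
Implicit Types (g : rel 'I_n) (k c : R).

Lemma psd_simplex : psd (n%:R%:M - const_mx 1 : 'M[R]_n).
Proof.
split=> [|x]; first by rewrite linearB /= tr_scalar_mx trmx_const.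
pose q : R := \sum_i \sum_j x 0 i * x 0 j; pose p : R := \sum_i x 0 i ^+ 2.
have -> : qform (n%:R%:M - const_mx 1) x = n%:R * p - q.
  rewrite qformE /p /q mulr_sumr -sumrB; apply: eq_bigr => i _.
  have -> : n%:R * x 0 i ^+ 2 = \sum_j n%:R * (i == j)%:R * (x 0 i * x 0 j).
    rewrite (bigD1 i) //= eqxx mulr1 big1 => [|j /negPf ji]; first by ring.
    by rewrite eq_sym ji mulr0 mul0r.
  by rewrite -sumrB; apply: eq_bigr => j _; rewrite !mxE -mulr_natr; ring.
have : 0 <= \sum_i \sum_j (x 0 i - x 0 j) ^+ 2.
  by apply: sumr_ge0 => i _; apply: sumr_ge0 => j _; rewrite sqr_ge0.
have -> : \sum_i \sum_j (x 0 i - x 0 j) ^+ 2 =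
    \sum_i \sum_(j < n) x 0 i ^+ 2 + \sum_(i < n) \sum_j x 0 j ^+ 2 - 2 * q.
  rewrite /q mulr_sumr -big_split -sumrB; apply: eq_bigr => i _ /=.
  by rewrite mulr_sumr -big_split -sumrB; apply: eq_bigr => j _ /=; ring.
rewrite [X in _ + X - _]exchange_big /=.
have -> : \sum_i \sum_(j < n) x 0 i ^+ 2 = n%:R * p.
  rewrite /p mulr_sumr; apply: eq_bigr => i _.
  by rewrite sumr_const card_ord mulr_natl.
lra.
Qed.

(** The Gram matrix is [(k - 1)^-1 (k I - J + B)], with [B] the slack that rigidity allows at
    non-adjacent pairs. *)
Lemma rigid_of_psd g k (B : 'M[R]_n) : irreflexive g -> 1 < k ->
  psd (k%:M - const_mx 1 + B) -> (forall i, B i i = 0) ->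
  (forall i j, g i j -> B i j = 0) ->
  (forall i j, i != j -> ~~ g i j -> 0 <= B i j) -> rigid_vector_coloring g k.
Proof.
move=> g_irr k1 psdP B0 Bg Bng.
have k10 : 0 < k - 1 by rewrite subr_gt0.
have kinv : 0 <= (k - 1)^-1 by rewrite invr_ge0 ltW.
have [V VE] := psd_factor (psdZ kinv psdP).
exists (fun i => row i V).
have dotE i j : dotv (row i V) (row j V) =
    (k - 1)^-1 * (k * (i == j)%:R - 1 + B i j).
  transitivity ((V *m V^T) i j).
    by rewrite /dotv !mxE; apply: eq_bigr => l _; rewrite !mxE.
  by rewrite -VE !mxE mulr_natr.
split; first by move=> i; rewrite dotE eqxx B0 mulr1 addr0 mulVf // gt_eqF.
split=> i j.
  move=> gij; have ij : i != j by apply: contraTneq gij => ->; rewrite g_irr.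
  by rewrite dotE (negPf ij) Bg // mulr0 addr0 sub0r mulrN1.
move=> ij ngij; rewrite dotE (negPf ij) mulr0 sub0r mulrDr mulrN1 lerDl.
by rewrite mulr_ge0 // Bng.
Qed.

Let set_half g := [set k : R | 1 < k /\ vector_coloring g k]%classic.
Let set_strict g := [set k : R | 1 < k /\ strict_vector_coloring g k]%classic.
Let set_rigid g := [set k : R | 1 < k /\ rigid_vector_coloring g k]%classic.

(** The regular simplex. It makes the three sets of admissible [k] nonempty; the [inf] of an empty
    set would take the default value 0. *)
Lemma rigid_n g : irreflexive g -> (1 < n)%N -> rigid_vector_coloring g (n%:R : R).
Proof.
move=> g_irr n1; apply: (@rigid_of_psd _ _ 0) => //; rewrite ?ltr1n ?addr0 //.
- exact: psd_simplex.
- by move=> i; rewrite mxE.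
- by move=> i j _; rewrite mxE.
- by move=> i j _ _; rewrite mxE.
Qed.

Let rigid_strict g : (set_rigid g `<=` set_strict g)%classic.
Proof. by move=> k [k1 [v [uv [h _]]]]; split=> //; exists v. Qed.

Let strict_half g : (set_strict g `<=` set_half g)%classic.
Proof.
by move=> k [k1 [v [uv h]]]; split=> //; exists v; split=> // i j /h ->.
Qed.

Let rigid_nonempty g : irreflexive g -> (1 < n)%N -> (set_rigid g !=set0)%classic.
Proof. by move=> gi n1; exists n%:R; split; [rewrite ltr1n | exact: rigid_n]. Qed.

Let lb_half g : has_lbound (set_half g).
Proof. by exists 1 => k [/ltW]. Qed.

Lemma thetabar_le_thetabar_2 g : irreflexive g -> (1 < n)%N ->
  (thetabar g : R) <= thetabar_2 g.
Proof.
move=> gi n1; apply: lb_le_inf; first exact: rigid_nonempty.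
move=> k /rigid_strict kg; apply: ge_inf => //.
by exists 1 => l [/ltW].
Qed.

Lemma thetabar_half_le_thetabar g : irreflexive g -> (1 < n)%N ->
  (thetabar_half g : R) <= thetabar g.
Proof.
move=> gi n1; apply: lb_le_inf.
  by have [k /rigid_strict] := rigid_nonempty gi n1; exists k.
by move=> k /strict_half kg; apply: ge_inf; [exact: lb_half | exact: kg].
Qed.

Lemma thetabar_half_ge g c : irreflexive g -> (1 < n)%N ->
  (forall k, 1 < k -> vector_coloring g k -> c <= k) -> c <= thetabar_half g.
Proof.
move=> gi n1 h; apply: lb_le_inf.
  by have [k /rigid_strict/strict_half] := rigid_nonempty gi n1; exists k.
by move=> k [k1 kg]; apply: h.
Qed.

Lemma thetabar_2_le g k : 1 < k -> rigid_vector_coloring g k -> thetabar_2 g <= k.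
Proof. by move=> k1 kg; apply: ge_inf; [exists 1 => l [/ltW] | split]. Qed.

End ThetaOrder.

Lemma adj_irr n (E : {set {set 'I_n}}) : irreflexive (adj E).
Proof. by move=> i; rewrite /adj eqxx. Qed.

Lemma compl_rel_irr n (g : rel 'I_n) : irreflexive (compl_rel g).
Proof. by move=> i; rewrite /compl_rel eqxx. Qed.

(** * Sums of vectors under bounded discrepancy *)

Section Estimates.
Variables (R : realType) (n r : nat) (E : {set {set 'I_n}}).
Hypotheses (n0 : (0 < n)%N) (r0 : (0 < r)%N).
Hypothesis regE : is_regular_graph r E.
Local Notation K := (discrepancy_const R).
Local Notation A i j := ((adj E i j)%:R : R).
Local Notation s := (Num.sqrt (r%:R : R)).
Local Notation q := (r%:R / n%:R : R).

Let nR : 0 < n%:R :> R. Proof. by rewrite ltr0n. Qed.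
Let rR : 0 < r%:R :> R. Proof. by rewrite ltr0n. Qed.
Let s0 : 0 < s. Proof. by rewrite sqrtr_gt0. Qed.
Let s2 : s ^+ 2 = r%:R. Proof. by rewrite sqr_sqrtr. Qed.
Let K0 : 0 < K. Proof. exact: discrepancy_const_gt0. Qed.

Lemma cutE_sub_mean (S T : {set 'I_n}) :
  cutE R E S T - cut_mean R r S T = \sum_(i in S) \sum_(j in T) (A i j - q).
Proof.
rewrite /cutE /cut_mean.
under [RHS]eq_bigr do rewrite sumrB sumr_const -mulr_natl.
by rewrite sumrB sumr_const -[in RHS]mulr_natl; ring.
Qed.

Section Vectors.
Variables (I : finType) (w : 'I_n -> I -> R).

Definition sumv (U : {set 'I_n}) (k : I) : R := \sum_(i in U) w i k.

Lemma ipf_sumv (U V : {set 'I_n}) :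
  ipf (sumv U) (sumv V) = \sum_(i in U) \sum_(j in V) ipf (w i) (w j).
Proof.
rewrite /ipf /sumv; under eq_bigr do rewrite big_distrlr /=.
rewrite exchange_big /=; apply: eq_bigr => i _.
by rewrite exchange_big.
Qed.

(** 32 is the 8 of Grothendieck's inequality times the 4 of [box_bound_cut]. Zeroing the matrix
    outside U x U reduces arbitrary cuts to cuts inside [U], where [level_ok] applies. *)
Lemma level_form (t : nat) (U : {set 'I_n}) (rho : R) :
  level_ok R r t E -> #|U|%:R <= n%:R / 16 ^+ t :> R -> 0 < rho ->
  (forall i, i \in U -> ipf (w i) (w i) <= rho ^+ 2) ->
  `|\sum_(i in U) \sum_(j in U) (A i j - q) * ipf (w i) (w j)| <=
    32 * (K * s * (n%:R / 32 ^+ t)) * rho ^+ 2.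
Proof.
move=> ok cU rho0 hw; set D := K * s * _.
pose M i j : R := if (i \in U) && (j \in U) then A i j - q else 0.
have cutM (S T : {set 'I_n}) : `|\sum_(i in S) \sum_(j in T) M i j| <= D.
  have sub (V : {set 'I_n}) : #|(V :&: U)%SET|%:R <= n%:R / 16 ^+ t :> R.
    by apply: le_trans cU; rewrite ler_nat subset_leq_card // finset.subsetIr.
  have := ok (S :&: U)%SET (T :&: U)%SET (sub S) (sub T).
  rewrite cutE_sub_mean; congr (`|_| <= _).
  rewrite [LHS]big_mkcond [RHS]big_mkcond; apply: eq_bigr => i _.
  rewrite inE /M; case: (i \in S) => //=; case: (i \in U) => /=; last by rewrite big1.
  rewrite [LHS]big_mkcond [RHS]big_mkcond; apply: eq_bigr => j _.
  by rewrite inE; case: (j \in T); case: (j \in U).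
pose v i k := if i \in U then rho^-1 * w i k else 0.
have v1 i : ipf (v i) (v i) <= 1.
  rewrite /v; case iU: (i \in U).
    by rewrite ipfZ exprVn mulrC ler_pdivrMr ?exprn_gt0 // mul1r hw.
  by rewrite /ipf big1 // => k _; rewrite mul0r.
have := grothendieck (box_bound_cut cutM) v1 v1.
have -> : \sum_i \sum_j M i j * ipf (v i) (v j) =
    rho ^- 2 * \sum_(i in U) \sum_(j in U) (A i j - q) * ipf (w i) (w j).
  rewrite mulr_sumr [RHS]big_mkcond; apply: eq_bigr => i _.
  rewrite /M; case iU : (i \in U) => /=; last by rewrite big1 // => j _; rewrite mul0r.
  rewrite mulr_sumr [RHS]big_mkcond; apply: eq_bigr => j _.
  case jU : (j \in U) => /=; last by rewrite mul0r.
  by rewrite /v iU jU ipfZ exprVn; ring.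
rewrite normrM ger0_norm ?invr_ge0 ?exprn_ge0 ?(ltW rho0) //.
rewrite mulrC ler_pdivrMr ?exprn_gt0 // mulrA.
by rewrite (_ : 8 * 4 = 32) //; ring.
Qed.

(** The edge terms are nonpositive, so the form is at most [-q] times the squared norm of the sum;
    its lower bound therefore limits the sum. *)
Lemma sumv_le (t : nat) (U : {set 'I_n}) (rho : R) :
  level_ok R r t E -> #|U|%:R <= n%:R / 16 ^+ t :> R -> 0 < rho ->
  (forall i, i \in U -> ipf (w i) (w i) <= rho ^+ 2) ->
  (forall i j, adj E i j -> ipf (w i) (w j) <= 0) ->
  ipf (sumv U) (sumv U) <= 32 * K * (n%:R ^+ 2 / s) / 32 ^+ t * rho ^+ 2.
Proof.
move=> ok cU rho0 hw hE.
have := level_form ok cU rho0 hw.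
have -> : \sum_(i in U) \sum_(j in U) (A i j - q) * ipf (w i) (w j) =
  \sum_(i in U) \sum_(j in U) A i j * ipf (w i) (w j) - q * ipf (sumv U) (sumv U).
  rewrite ipf_sumv mulr_sumr -sumrB; apply: eq_bigr => i _.
  by rewrite mulr_sumr -sumrB; apply: eq_bigr => j _; rewrite mulrBl.
have : \sum_(i in U) \sum_(j in U) A i j * ipf (w i) (w j) <= 0.
  apply: sumr_le0 => i _; apply: sumr_le0 => j _.
  by case Aij: (adj E i j); rewrite ?mul0r ?mul1r // hE.
set a := \sum_(i in U) _ => a0; rewrite ler_norml => /andP[h _].
have h1 : q * ipf (sumv U) (sumv U) <= 32 * (K * s * (n%:R / 32 ^+ t)) * rho ^+ 2 by lra.
rewrite -(ler_pM2l (_ : 0 < q)) ?divr_gt0 //; apply: le_trans h1 _.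
rewrite le_eqVlt; apply/orP; left; apply/eqP.
move: s0 s2; move: s => z z0 <-; field.
by rewrite expf_eq0 pnatr_eq0 andbF !gt_eqF.
Qed.

Lemma sumv_split (U V : {set 'I_n}) k : V \subset U ->
  sumv U k = sumv (U :\: V)%SET k + sumv V k.
Proof.
move=> VU; rewrite /sumv (big_setID V) /= addrC; congr (_ + _).
by rewrite (finset.setIidPr VU).
Qed.

(** The weights suit the ratio 9/16 of [sumv_level]: [4/3 * 9/16 = 3/4], and the 16 of [sumv_levels]
    solves [c = 4 + 3/4 c]. Equal weights would give the ratio 9/8, and the constant would grow with
    the number of levels. *)
Lemma ipf_addr_le (a b c : I -> R) : (forall k, c k = a k + b k) ->
  ipf c c <= 4 * ipf a a + 4 / 3 * ipf b b.
Proof.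
move=> cE; rewrite /ipf !mulr_sumr -big_split /=; apply: ler_sum => k _; rewrite cE.
by have := sqr_ge0 (3 * a k - b k); lra.
Qed.

Lemma ipf_addr_le2 (a b c : I -> R) : (forall k, c k = a k + b k) ->
  ipf c c <= 2 * ipf a a + 2 * ipf b b.
Proof.
move=> cE; rewrite /ipf !mulr_sumr -big_split /=; apply: ler_sum => k _; rewrite cE.
by have := sqr_ge0 (a k - b k); lra.
Qed.

Lemma sumv_crude (U : {set 'I_n}) :
  ipf (sumv U) (sumv U) <= #|U|%:R * \sum_(i in U) ipf (w i) (w i).
Proof.
rewrite ipf_sumv.
have le2 i j : 2 * ipf (w i) (w j) <= ipf (w i) (w i) + ipf (w j) (w j).
  rewrite /ipf mulr_sumr -big_split /=; apply: ler_sum => k _.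
  by have := sqr_ge0 (w i k - w j k); lra.
have -> : #|U|%:R * \sum_(i in U) ipf (w i) (w i) =
    \sum_(i in U) \sum_(j in U) ipf (w i) (w i).
  by rewrite mulr_sumr; apply: eq_bigr => i _; rewrite sumr_const mulr_natl.
have : 2 * \sum_(i in U) \sum_(j in U) ipf (w i) (w j) <=
    \sum_(i in U) \sum_(j in U) ipf (w i) (w i) +
    \sum_(i in U) \sum_(j in U) ipf (w j) (w j).
  rewrite mulr_sumr -big_split /=; apply: ler_sum => i _.
  by rewrite mulr_sumr -big_split /=; apply: ler_sum => j _.
rewrite [X in _ + X]exchange_big /=; lra.
Qed.

Definition large (t : nat) : {set 'I_n} := [set i | 16 ^+ t < ipf (w i) (w i)].

Lemma large_subset t t' : (t <= t')%N -> large t' \subset large t.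
Proof.
move=> tt; apply/fintype.subsetP => i; rewrite !inE; apply: le_lt_trans.
by apply: ler_weXn2l; rewrite // ler1n.
Qed.

Hypothesis w_total : \sum_i ipf (w i) (w i) = n%:R.

Lemma card_large t : #|large t|%:R <= n%:R / 16 ^+ t :> R.
Proof.
rewrite ler_pdivlMr ?exprn_gt0 // -w_total (bigID (mem (large t))) /=.
have -> : #|large t|%:R * 16 ^+ t = \sum_(i in large t) 16 ^+ t :> R.
  by rewrite sumr_const mulr_natl.
apply: ler_wpDr; first by apply: sumr_ge0 => i _; exact: ipf_ge0.
by apply: ler_sum => i; rewrite inE => /ltW.
Qed.

Hypothesis w_edges : forall i j, adj E i j -> ipf (w i) (w j) <= 0.

Let C : R := 512 * K * (n%:R ^+ 2 / s).

Let C0 : 0 < C. Proof.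
apply: mulr_gt0; last by rewrite divr_gt0 ?exprn_gt0.
by apply: mulr_gt0; [rewrite ltr0n | exact: K0].
Qed.

Lemma sumv_level t : level_ok R r t E ->
  ipf (sumv (large t :\: large t.+1)%SET) (sumv (large t :\: large t.+1)%SET) <=
  C * (9 / 16) ^+ t.
Proof.
move=> ok.
have cU : #|(large t :\: large t.+1)%SET|%:R <= n%:R / 16 ^+ t :> R.
  apply: le_trans (card_large t); rewrite ler_nat subset_leq_card //.
  exact: finset.subsetDl.
have rho0 : 0 < 4 ^+ t.+1 :> R by rewrite exprn_gt0.
have e16 : (4 ^+ t.+1) ^+ 2 = 16 ^+ t.+1 :> R.
  by rewrite -exprM mulnC exprM; congr (_ ^+ _); ring.
apply: le_trans (sumv_le ok cU rho0 _ w_edges) _.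
  by move=> i; rewrite !inE -leNgt e16 => /andP[].
rewrite e16.
have -> : 32 * K * (n%:R ^+ 2 / s) / 32 ^+ t * 16 ^+ t.+1 = C * (16 / 32) ^+ t.
  rewrite /C (exprS 16 t) expr_div_n; move: (32 ^+ t)^-1 (16 ^+ t) (n%:R ^+ 2 / s) => a b z.
  by ring.
rewrite ler_pM2l //; apply: lerXn2r; rewrite ?nnegrE; lra.
Qed.

Lemma sumv_levels tt d : (forall t, (t < tt)%N -> level_ok R r t E) -> (d <= tt)%N ->
  let U := (large (tt - d) :\: large tt)%SET in
  ipf (sumv U) (sumv U) <= 16 * C * (9 / 16) ^+ (tt - d).
Proof.
move=> ok; elim: d => [|d IH] dt /=.
  rewrite subn0 finset.setDv /ipf big1 => [|k _].
    by apply: mulr_ge0; [have := ltW C0; lra | rewrite exprn_ge0 // divr_ge0].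
  by rewrite /sumv big_set0 mul0r.
have {IH} := IH (ltnW dt); rewrite /=.
have -> : (tt - d = (tt - d.+1).+1)%N by rewrite subnSK.
set t := (tt - d.+1)%N => IH.
have ttt : (t < tt)%N by rewrite /t -subn_gt0 subKn.
have := sumv_level (ok t ttt) => H.
have := @ipf_addr_le (sumv (large t :\: large t.+1)%SET)
  (sumv (large t.+1 :\: large tt)%SET) (sumv (large t :\: large tt)%SET).
have subU : (large t.+1 :\: large tt)%SET \subset (large t :\: large tt)%SET.
  by apply: finset.setSD; apply: large_subset.
have eU : (large t :\: large tt :\: (large t.+1 :\: large tt))%SET =
    (large t :\: large t.+1)%SET.
  have /fintype.subsetP sub := large_subset ttt.
  apply/setP => i; rewrite !inE.
  have := sub i; rewrite !inE; case: (16 ^+ tt < _) => [->|_] //=; rewrite ?andbF //.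
move=> /(_ _)h; have {h} := h (fun k => etrans (sumv_split k subU)
  (congr1 (fun V => sumv V k + _) eU)).
rewrite exprS in IH; lra.
Qed.

(** Level 0 also serves the vertices of squared norm at most 1, and is assumed separately because
    [tt] may be 0. With [N = n^2 / s], the small, middle and large vertices cost [64 K N],
    [32768 K N] and [4 N]. *)
Lemma sumv_total tt :
  level_ok R r 0 E -> (forall t, (t < tt)%N -> level_ok R r t E) -> s <= 16 ^+ tt ->
  ipf (sumv [set: 'I_n]%SET) (sumv [set: 'I_n]%SET) <= 256 * 256 * K * (n%:R ^+ 2 / s).
Proof.
move=> ok0 ok stt.
set N := n%:R ^+ 2 / s.
have N0 : 0 < N by rewrite divr_gt0 ?exprn_gt0.
have hbig : ipf (sumv (large tt)) (sumv (large tt)) <= N.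
  apply: le_trans (sumv_crude _) _.
  apply: (@le_trans _ _ (n%:R / 16 ^+ tt * n%:R)).
    apply: ler_pM => //; first by apply: sumr_ge0 => i _; exact: ipf_ge0.
      exact: card_large.
    rewrite -w_total [leRHS](bigID (mem (large tt))) /= lerDl.
    by apply: sumr_ge0 => i _; exact: ipf_ge0.
  rewrite /N mulrAC -expr2 ler_pM2l ?exprn_gt0 // lef_pV2 // posrE //.
have hlev := sumv_levels ok (leqnn tt); rewrite /= subnn expr0 mulr1 in hlev.
have hsmall : ipf (sumv ([set: 'I_n] :\: large 0)%SET) (sumv ([set: 'I_n] :\: large 0)%SET) <=
    32 * K * N.
  have := @sumv_le 0 ([set: 'I_n] :\: large 0)%SET 1 ok0.
  rewrite !expr0 !divr1 expr1n mulr1; apply => //.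
    by rewrite ler_nat -[leqRHS]card_ord max_card.
  by move=> i; rewrite !inE andbT -leNgt expr0.
have h1 := ipf_addr_le2 (fun k => sumv_split k (large_subset (leq0n tt))).
have h2 := ipf_addr_le2 (fun k => sumv_split k (finset.subsetT (large 0))).
have K1 := discrepancy_const_ge1 R.
have NK : N <= K * N by rewrite ler_peMl // ltW.
have CE : C = 512 * (K * N) by rewrite /C /N; ring.
rewrite CE in hlev; rewrite -(mulrA _ K) in hsmall; rewrite -(mulrA _ K).
lra.
Qed.

End Vectors.

End Estimates.

(** * Bounds on the vector chromatic numbers of a fixed graph *)

Section ThetaBounds.
Variables (R : realType) (n r : nat) (E : {set {set 'I_n}}).
Hypotheses (n1 : (1 < n)%N) (r0 : (0 < r)%N).
Hypothesis regE : is_regular_graph r E.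
Local Notation K := (discrepancy_const R).
Local Notation A i j := ((adj E i j)%:R : R).
Local Notation s := (Num.sqrt (r%:R : R)).
Local Notation q := (r%:R / n%:R : R).

Let n0 : (0 < n)%N. Proof. exact: ltnW. Qed.
Let nR : 0 < n%:R :> R. Proof. by rewrite ltr0n. Qed.
Let rR : 0 < r%:R :> R. Proof. by rewrite ltr0n. Qed.
Let s0 : 0 < s. Proof. by rewrite sqrtr_gt0. Qed.
Let s2 : s ^+ 2 = r%:R. Proof. by rewrite sqr_sqrtr. Qed.
Let K1 : 1 <= K. Proof. exact: discrepancy_const_ge1. Qed.
Let K0 : 0 < K. Proof. exact: discrepancy_const_gt0. Qed.

Let vec (v : 'I_n -> 'rV[R]_n) i k : R := v i 0 k.

Let dotvE v i j : dotv (v i) (v j) = ipf (vec v i) (vec v j).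
Proof. by rewrite /dotv mxE; apply: eq_bigr => k _; rewrite mxE. Qed.

Let unit_form v : level_ok R r 0 E -> unit_family v ->
  `|\sum_i \sum_j A i j * dotv (v i) (v j) - q * \sum_i \sum_j dotv (v i) (v j)|
  <= 32 * (K * s * n%:R).
Proof.
move=> ok uv; have := @level_form R n r E _ (vec v) 0 [set: 'I_n]%SET 1 ok.
rewrite !expr0 !divr1 expr1n mulr1 cardsT card_ord => /(_ (lexx _) ltr01).
move=> h; apply: le_trans (h _); last by move=> i _; rewrite -dotvE uv.
rewrite le_eqVlt; apply/orP; left; apply/eqP; congr `|_|.
rewrite mulr_sumr -sumrB; apply: eq_big => [i|i _]; first by rewrite inE.
rewrite mulr_sumr -sumrB; apply: eq_big => [j|j _]; first by rewrite inE.
by rewrite -dotvE mulrBl.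
Qed.

Let gram_ge0 (v : 'I_n -> 'rV[R]_n) : 0 <= \sum_i \sum_j dotv (v i) (v j).
Proof.
have := ipf_ge0 (sumv (vec v) [set: 'I_n]%SET); rewrite ipf_sumv; congr (_ <= _).
apply: eq_big => [i|i _]; first by rewrite inE.
by apply: eq_big => [j|j _]; rewrite ?inE // dotvE.
Qed.

(** The edges contribute at most [- n r / (k - 1)] to the form and [- q X] lowers it further, while
    the discrepancy keeps it above [- 32 K s n]. *)
Lemma thetabar_half_lower : level_ok R r 0 E -> (32 * K)^-1 * s <= thetabar_half (adj E).
Proof.
move=> ok; apply: thetabar_half_ge => //; first exact: adj_irr.
move=> k k1 [v [uv hv]].
have k10 : 0 < k - 1 by rewrite subr_gt0.
have := unit_form ok uv; have := gram_ge0 v.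
set X := \sum_i \sum_j dotv _ _; set Y := \sum_i _ => X0.
have hY : Y <= - (k - 1)^-1 * (n%:R * r%:R).
  apply: (@le_trans _ _ (\sum_i \sum_j - (k - 1)^-1 * A i j)).
    apply: ler_sum => i _; apply: ler_sum => j _; rewrite mulrC.
    by case Aij: (adj E i j); rewrite ?mulr0 ?mulr1 // hv.
  under eq_bigr do rewrite -mulr_sumr (sum_adj _ _ regE).
  by rewrite sumr_const card_ord -(mulr_natl (_ * _)) mulrCA.
have qX : 0 <= q * X by rewrite mulr_ge0 // divr_ge0.
rewrite ler_norml => /andP[h _].
have h1 : (k - 1)^-1 * (n%:R * r%:R) <= 32 * (K * s * n%:R) by lra.
rewrite mulrC ler_pdivrMr // in h1.
have h2 : s * (n%:R * s) <= (32 * K * (k - 1)) * (n%:R * s).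
  have -> : s * (n%:R * s) = n%:R * r%:R by rewrite -[in RHS]s2; ring.
  lra.
rewrite ler_pM2r ?mulr_gt0 // in h2.
rewrite mulrC ler_pdivrMr ?mulr_gt0 //; apply: le_trans h2 _.
have : 32 * K * k = 32 * K * (k - 1) + 32 * K by ring.
by rewrite [k * _]mulrC => ->; rewrite lerDl mulr_ge0 // ltW.
Qed.

(** Now at least [n^2 / 2] ordered pairs are non-edges and pull [X] down. As [q <= 1],
    [a n^2 / 2 <= n + Y - X <= n + Y - q X]; the diagonal term [n] is absorbed in [K s n], whence 33
    = 32 + 1. *)
Lemma theta_half_lower : level_ok R r 0 E -> (2 * (1 + r) <= n)%N ->
  (66 * K)^-1 * n%:R / s <= theta_half (adj E).
Proof.
move=> ok rn; have r_le_n : (r <= n)%N by lia.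
have rnR : 2 * (1 + r%:R) <= n%:R :> R by rewrite -(ler_nat R) natrM natrD in rn.
apply: thetabar_half_ge => //; first exact: compl_rel_irr.
move=> k k1 [v [uv hv]].
have k10 : 0 < k - 1 by rewrite subr_gt0.
pose a := (k - 1)^-1; have a0 : 0 < a by rewrite invr_gt0.
have := unit_form ok uv; have := gram_ge0 v.
set X := \sum_i \sum_j dotv _ _; set Y := \sum_i _ => X0.
have hX : X <= n%:R + Y - a * (n%:R ^+ 2 - n%:R - n%:R * r%:R).
  have -> : n%:R + Y - a * (n%:R ^+ 2 - n%:R - n%:R * r%:R) =
    \sum_i \sum_j ((i == j)%:R + A i j * dotv (v i) (v j) - a * (1 - (i == j)%:R - A i j)).
    under [RHS]eq_bigr do rewrite sumrB big_split -mulr_sumr !sumrB /=.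
    rewrite sumrB big_split -mulr_sumr !sumrB /= -/Y.
    have diag : \sum_(i < n) \sum_(j < n) (i == j)%:R = n%:R :> R.
      rewrite -[in RHS](card_ord n) -sumr_const; apply: eq_bigr => i _.
      by rewrite (bigD1 i) //= eqxx big1 ?addr0 // => j /negPf ji; rewrite eq_sym ji.
    rewrite diag; congr (_ - _ * (_ - _ - _)).
      by under eq_bigr do rewrite sumr_const card_ord; rewrite sumr_const card_ord -mulrnA natrM expr2.
    under eq_bigr do rewrite (sum_adj _ _ regE).
    by rewrite sumr_const card_ord mulr_natl.
  apply: ler_sum => i _; apply: ler_sum => j _.
  have [->|ij] := eqVneq i j.
    by rewrite uv /adj eqxx /= mul0r addr0 subrr !subr0 mulr0 subr0.
  case Aij: (adj E i j); first by rewrite mul1r add0r subr0 subrr mulr0 subr0.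
  rewrite mul0r addr0 !subr0 mulr1 sub0r; apply: hv.
  by rewrite /compl_rel ij Aij.
rewrite ler_norml => /andP[_ h].
have q1 : q <= 1 by rewrite ler_pdivrMr // mul1r ler_nat.
have qX : q * X <= X by rewrite -[leRHS]mul1r ler_wpM2r.
have r1 : 1 <= r%:R :> R by rewrite ler1n.
have s1 : 1 <= s by rewrite -(ler_pXn2r (n := 2)) ?nnegrE // ?sqrtr_ge0 // s2 expr1n.
have Ks : 1 <= K * s by apply: le_trans K1 _; rewrite ler_peMr // ltW.
have nKs : n%:R <= K * s * n%:R by rewrite ler_peMl // ltW.
have hn : n%:R ^+ 2 / 2 <= n%:R ^+ 2 - n%:R - n%:R * r%:R :> R.
  have : n%:R * (2 * (1 + r%:R)) <= n%:R * n%:R :> R.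
    by rewrite ler_pM2l // (le_trans _ rnR).
  lra.
have h1 : a * (n%:R ^+ 2 / 2) <= 33 * (K * s * n%:R).
  have : a * (n%:R ^+ 2 / 2) <= a * (n%:R ^+ 2 - n%:R - n%:R * r%:R).
    by rewrite ler_pM2l.
  lra.
have h2 : n%:R * n%:R <= (66 * K * s * (k - 1)) * n%:R.
  rewrite /a mulrC ler_pdivrMr // in h1; lra.
rewrite ler_pM2r // in h2.
rewrite ler_pdivrMr // mulrC ler_pdivrMr ?mulr_gt0 //; apply: le_trans h2 _.
have : k * s * (66 * K) = 66 * K * s * (k - 1) + 66 * K * s by ring.
by move=> ->; rewrite lerDl !mulr_ge0 // ltW.
Qed.

(** Duality for [adj E] yields a nonnegative [B] supported on the edges of G. These are the
    non-adjacent pairs of the complement, exactly where a rigid coloring of it may have slack. *)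
Lemma theta_2_upper tt : (r < n)%N -> level_ok R r 0 E ->
  (forall t, (t < tt)%N -> level_ok R r t E) -> s <= 16 ^+ tt ->
  theta_2 (adj E) <= 256 * 256 * K * n%:R / s.
Proof.
move=> rn ok0 ok stt; set kappa := 256 * 256 * K * n%:R / s.
have r1 : 1 <= r%:R :> R by rewrite ler1n.
have s1 : 1 <= s by rewrite -(ler_pXn2r (n := 2)) ?nnegrE // ?sqrtr_ge0 // s2 expr1n.
have sn : s <= n%:R.
  have : s <= s ^+ 2 by rewrite expr2 ler_peMr // ltW.
  by move/le_trans; apply; rewrite s2 ler_nat ltnW.
have kappa1 : 1 < kappa.
  rewrite /kappa ltr_pdivlMr // mul1r; apply: le_lt_trans sn _.
  rewrite -[ltLHS]mul1r ltr_pM2r //; have := K1; lra.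
have esym : symmetric (adj E) by move=> i j; exact: adjC.
have [|B [Badj Bnadj psdB]] := sdp_duality (kappa := kappa) esym (@adj_irr _ E).
  move=> W hW; pose w i k := W i k.
  have WE i j : (W *m W^T) i j = ipf (w i) (w j).
    by rewrite mxE; apply: eq_bigr => k _; rewrite mxE.
  pose T := \tr (W *m W^T).
  have TE : T = \sum_i ipf (w i) (w i) by apply: eq_bigr => i _; rewrite WE.
  have T0 : 0 <= T by rewrite TE; apply: sumr_ge0 => i _; exact: ipf_ge0.
  have sumE : \sum_i \sum_j (W *m W^T) i j = ipf (sumv w [set: 'I_n]%SET) (sumv w [set: 'I_n]%SET).
    rewrite ipf_sumv; apply: eq_big => [i|i _]; first by rewrite inE.
    by apply: eq_big => [j|j _]; rewrite ?inE // WE.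
  rewrite sumE -/T; have [T00|Tn0] := eqVneq T 0.
    rewrite T00 mulr0; have h0 := sumv_crude w [set: 'I_n]%SET; apply: le_trans h0 _.
    have -> : \sum_(i in [set: 'I_n]%SET) ipf (w i) (w i) = 0.
      transitivity T => //; rewrite TE; apply: eq_bigl => i; by rewrite inE.
    by rewrite mulr0.
  have Tp : 0 < T by rewrite lt_neqAle eq_sym Tn0.
  (* The claim is homogeneous of degree 2, so the total squared norm may be scaled to [n]. *)
  pose l := Num.sqrt (n%:R / T).
  have l2 : l ^+ 2 = n%:R / T by rewrite sqr_sqrtr // divr_ge0.
  pose w' i k := l * w i k.
  have w'_total : \sum_i ipf (w' i) (w' i) = n%:R.
    by under eq_bigr do rewrite ipfZ; rewrite -mulr_sumr -TE l2 divfK.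
  have w'_edges i j : adj E i j -> ipf (w' i) (w' j) <= 0.
    move=> eij; rewrite ipfZ; apply: mulr_ge0_le0; first exact: sqr_ge0.
    by rewrite -WE hW.
  have := sumv_total n0 r0 w'_total w'_edges ok0 ok stt.
  have -> : ipf (sumv w' [set: 'I_n]%SET) (sumv w' [set: 'I_n]%SET) =
      n%:R / T * ipf (sumv w [set: 'I_n]%SET) (sumv w [set: 'I_n]%SET).
    rewrite -l2 -ipfZ; apply: eq_bigr => k _.
    by rewrite /sumv !mulr_sumr.
  rewrite mulrAC ler_pdivrMr //; set X := ipf _ _ => h.
  rewrite -(ler_pM2l nR); apply: le_trans h _.
  rewrite le_eqVlt; apply/orP; left; apply/eqP; rewrite /kappa.
  by move: (256 * 256 * K) s => a b; ring.
apply: thetabar_2_le => //.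
apply: (rigid_of_psd _ kappa1 psdB); first exact: compl_rel_irr.
- by move=> i; apply: Bnadj; rewrite adj_irr.
- by move=> i j /andP[_]; exact: Bnadj.
- by move=> i j ij; rewrite /compl_rel ij /= negbK; exact: Badj.
Qed.

End ThetaBounds.

(* prob_Gnr counts classical sets, since Defs opens classical_set_scope. *)
Lemma card_classic_set (T : finType) (p : pred T) :
  #|[set x | p x]%classic| = #|[set x | p x]|.
Proof.
by apply: eq_card => x; rewrite [RHS]inE; apply/idP/idP => [/set_mem|/mem_set].
Qed.

Lemma prob_Gnr_ge (R : realType) (n r : nat) (P Q : {set {set 'I_n}} -> Prop) (d : R) :
  (0 < #|regular_graphs n r|)%N ->
  (forall E, is_regular_graph r E -> Q E -> P E) ->
  #|[set E in regular_graphs n r | ~~ `[< Q E >]]|%:R <= d * #|regular_graphs n r|%:R ->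
  1 - d <= prob_Gnr n r P.
Proof.
move=> G0 QP bad; rewrite /prob_Gnr !card_classic_set -/(regular_graphs n r).
rewrite ler_pdivlMr ?ltr0n // mulrBl mul1r lerBlDr.
apply: (@le_trans _ _ (#|[set E | is_regular_graph r E && `[< P E >]]|%:R +
  #|[set E in regular_graphs n r | ~~ `[< Q E >]]|%:R)); last by rewrite lerD2l.
rewrite -natrD ler_nat; apply: leq_trans (leq_card_setU _ _).
apply: subset_leq_card; apply/fintype.subsetP => E; rewrite !inE => rE.
rewrite rE /=; case: (asboolP (Q E)) => [/(QP _ rE) PE|_]; last by rewrite orbT.
by rewrite asboolT.
Qed.

(** * Probability that some level fails *)

Section Probability.
Variable R : realType.
Local Notation K := (discrepancy_const R).

Lemma nat_le_sqrt_sqr (r n : nat) : r%:R <= 1 * Num.sqrt (n%:R : R) -> (r ^ 2 <= n)%N.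
Proof.
rewrite mul1r => h; rewrite -(ler_nat R) natrX -[leRHS]sqr_sqrtr //.
by apply: lerXn2r; rewrite ?nnegrE ?sqrtr_ge0.
Qed.

Lemma sqrt_natr_le (n : nat) : Num.sqrt (n%:R : R) <= n%:R.
Proof.
case: n => [|n]; first by rewrite sqrtr0.
rewrite -[leRHS]ger0_norm // -sqrtr_sqr ler_wsqrtr // -natrX ler_nat.
by rewrite leq_pmulr.
Qed.

Lemma sqrt_level (r : nat) : exists2 tt : nat,
  Num.sqrt r%:R <= 16 ^+ tt :> R &
  forall t, (t < tt)%N -> 16 ^+ t < Num.sqrt r%:R :> R.
Proof.
have ex : exists t : nat, Num.sqrt r%:R <= 16 ^+ t :> R.
  exists r; apply: le_trans (sqrt_natr_le r) _.
  by rewrite -natrX ler_nat ltnW // ltn_expl.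
case: (ex_minnP ex) => tt h1 h2; exists tt => // t ttt.
by rewrite ltNge; apply: contraL ttt => /h2; rewrite -leqNgt.
Qed.

Lemma sum_pow16 (tt : nat) : \sum_(t < tt) 16 ^+ t <= 16 ^+ tt :> R.
Proof.
elim: tt => [|tt IH]; first by rewrite big_ord0 expr0.
rewrite big_ord_recr /= exprS; have : 0 <= 16 ^+ tt :> R by rewrite exprn_ge0.
lra.
Qed.

(** [exp(-x) <= 1 / x] bounds the failure of level t by [16^t / n]. The last level used is below
    [s], so the geometric sum is at most [16 s]; the rest of 17 pays for level 0, counted
    separately. *)
Lemma all_levels_fail (n r tt : nat) :
  (256 <= n)%N -> (0 < r)%N -> (r ^ 2 <= n)%N ->
  (forall t, (t < tt)%N -> 16 ^+ t < Num.sqrt (r%:R : R)) ->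
  #|[set E in regular_graphs n r |
      ~~ `[< level_ok R r 0 E /\ forall t, (t < tt)%N -> level_ok R r t E >]]|%:R <=
    17 * Num.sqrt r%:R / n%:R * #|regular_graphs n r|%:R :> R.
Proof.
move=> n256 r0 rn tts; set s := Num.sqrt _ in tts *.
have r1 : 1 <= r%:R :> R by rewrite ler1n.
have s1 : 1 <= s by rewrite -sqrtr1 ler_wsqrtr.
have nR : 0 < n%:R :> R by rewrite ltr0n; apply: leq_trans n256.
pose bad t := [set E in regular_graphs n r | ~~ `[< level_ok R r t E >]].
have bad_le t : 16 ^+ t <= 16 * s ->
    #|bad t|%:R <= 16 ^+ t / n%:R * #|regular_graphs n r|%:R :> R.
  move=> ts; apply: le_trans (level_fail n256 r0 rn ts) _.
  apply: ler_wpM2r => //.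
  have x0 : 0 < n%:R / 16 ^+ t :> R by rewrite divr_gt0 ?exprn_gt0.
  rewrite -(invf_div n%:R) expRN lef_pV2 ?posrE ?expR_gt0 //.
  by apply: le_trans (expR_ge1Dx _); rewrite lerDr.
have cntE (p : pred {set {set 'I_n}}) :
    #|[set E in regular_graphs n r | p E]| = (\sum_(E in regular_graphs n r) p E)%N.
  rewrite -sum1_card (eq_bigl (fun E => (E \in regular_graphs n r) && p E)).
    by rewrite big_mkcondr; apply: eq_bigr => E _; case: (p E).
  by move=> E; rewrite inE.
have union : (#|[set E in regular_graphs n r |
      ~~ `[< level_ok R r 0 E /\ forall t, (t < tt)%N -> level_ok R r t E >]]| <=
    #|bad 0| + \sum_(t < tt) #|bad t|)%N.
  rewrite (eq_bigr (fun t : 'I_tt => \sum_(E in regular_graphs n r) ~~ `[< level_ok R r t E >])%N);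
    last by move=> t _; rewrite -cntE.
  rewrite exchange_big /= !cntE -big_split /=; apply: leq_sum => E _.
  case: asboolP => [//|h] /=.
  have [ok0|//] := boolP `[< level_ok R r 0 E >].
  have [t ttt nok] : exists2 t, (t < tt)%N & ~~ `[< level_ok R r t E >].
    apply: contrapT => H; apply: h; split; first exact/asboolP.
    by move=> t ttt; apply: contrapT => nok; apply: H; exists t => //; exact/asboolPn.
  by rewrite (bigD1 (Ordinal ttt)) //= nok.
move: union; rewrite -(ler_nat R) natrD natr_sum => /le_trans; apply.
rewrite (_ : 17 * s / n%:R * _ = (16 ^+ 0 / n%:R + 16 * s / n%:R) * #|regular_graphs n r|%:R
   + (s - 1) / n%:R * #|regular_graphs n r|%:R); last by rewrite expr0; ring.
rewrite -[leLHS]addr0; apply: lerD; last by rewrite mulr_ge0 // divr_ge0 // subr_ge0.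
rewrite mulrDl; apply: lerD; first by apply: bad_le; rewrite expr0; clear -s1; lra.
apply: (@le_trans _ _ (\sum_(t < tt) 16 ^+ t / n%:R * #|regular_graphs n r|%:R)).
  apply: ler_sum => t _; apply: bad_le; apply: le_trans (ltW (tts t (ltn_ord t))) _.
  by rewrite ler_peMl //; clear -s1; lra.
rewrite -!mulr_suml; apply: ler_wpM2r => //; apply: ler_wpM2r; first by rewrite invr_ge0.
case: tt tts => [|tt] tts; first by rewrite big_ord0; clear -s1; lra.
apply: le_trans (sum_pow16 _) _; rewrite exprS ler_pM2l // ltW //.
by apply: tts.
Qed.

End Probability.

Theorem theorem5 (R : realType) :
  exists c0 : R,
  (* (a) *)
  (forall r : nat -> nat,
     (forall n, c0 <= (r n)%:R) ->
     (* r = o(n^{1/4}) *)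
     (forall eps : R, 0 < eps -> exists N : nat, forall n : nat, (N <= n)%N ->
        (r n)%:R <= eps * Num.sqrt (Num.sqrt (n%:R : R))) ->
     exists c1 c2 : R, 0 < c1 /\ 0 < c2 /\
       (* probability 1 - o(1), along n with r(n) n even *)
       (forall eps : R, 0 < eps -> exists N : nat, forall n : nat, (N <= n)%N ->
          ~~ odd (r n * n) ->
          1 - eps <= prob_Gnr n (r n) (fun E =>
            c1 * n%:R / Num.sqrt ((r n)%:R) <= (theta_half (adj E) : R) /\
            (theta_half (adj E) : R) <= (theta (adj E) : R) /\
            (theta (adj E) : R) <= (theta_2 (adj E) : R) /\
            (theta_2 (adj E) : R) <= c2 * n%:R / Num.sqrt ((r n)%:R)))) /\
  (* (b) *)
  (exists c3 : R, 0 < c3 /\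
     forall r : nat -> nat,
     (forall n, c0 <= (r n)%:R) ->
     (* r = o(n^{1/2}) *)
     (forall eps : R, 0 < eps -> exists N : nat, forall n : nat, (N <= n)%N ->
        (r n)%:R <= eps * Num.sqrt (n%:R : R)) ->
     exists N : nat, forall n : nat, (N <= n)%N -> ~~ odd (r n * n) ->
       1 - expR (- (n%:R : R)) <= prob_Gnr n (r n) (fun E =>
         c3 * Num.sqrt ((r n)%:R) <= (thetabar_half (adj E) : R) /\
         (thetabar_half (adj E) : R) <= (thetabar (adj E) : R) /\
         (thetabar (adj E) : R) <= (thetabar_2 (adj E) : R))).
Proof.
have K0 := discrepancy_const_gt0 R.
have r_gt0 (r : nat -> nat) : (forall n, (1 : R) <= (r n)%:R) -> forall n, (0 < r n)%N.
  by move=> h n; have := h n; rewrite ler1n.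
exists 1; split.
- move=> r r1 ro; exists (66 * discrepancy_const R)^-1, (256 * 256 * discrepancy_const R).
  have c0 : 0 < 66 * discrepancy_const R by apply: mulr_gt0; [rewrite ltr0n | exact: K0].
  have c0' : 0 < 256 * 256 * discrepancy_const R.
    by apply: mulr_gt0; [rewrite -natrM ltr0n | exact: K0].
  split; first by rewrite invr_gt0.
  split=> // eps eps0.
  have [N1 hN1] := ro 1 ltr01.
  (* 289 = 17^2: the failure bound [17 sqrt r / n] is at most [17 / sqrt n] when [r^2 <= n]. *)
  exists (maxn N1 (maxn 256 (Num.bound (289 / eps ^+ 2)))) => n.
  rewrite !geq_max => /and3P[nN1 n256 nN] ev.
  have r0 := r_gt0 _ r1 n.
  have rn : (r n ^ 2 <= n)%N.
    apply: nat_le_sqrt_sqr; apply: le_trans (hN1 n nN1) _.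
    rewrite !mul1r ler_wsqrtr //; exact: sqrt_natr_le.
  have rn2 : (2 * (1 + r n) <= n)%N by nia.
  have rltn : (r n < n)%N by lia.
  have n1 : (1 < n)%N by apply: leq_trans n256.
  have [tt stt tts] := sqrt_level R (r n).
  have fail := all_levels_fail n256 r0 rn tts.
  have epsn : 17 * Num.sqrt (r n)%:R / n%:R <= eps.
    rewrite ler_pdivrMr ?ltr0n ?(ltnW n1) //.
    apply: (@le_trans _ _ (17 * (r n)%:R)); first by rewrite ler_pM2l // sqrt_natr_le.
    rewrite -(ler_pXn2r (n := 2)) ?nnegrE ?mulr_ge0 // ?(ltW eps0) // !exprMn.
    have h1 : (r n)%:R ^+ 2 <= n%:R :> R by rewrite -natrX ler_nat.
    have h2 : 289 <= eps ^+ 2 * n%:R.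
      rewrite mulrC -ler_pdivrMr ?exprn_gt0 //.
      apply: le_trans (ltW (archi_boundP _)) _; first by rewrite divr_ge0 ?ler0n ?sqr_ge0.
      by rewrite ler_nat.
    have h3 : 289 * n%:R <= eps ^+ 2 * n%:R * n%:R by rewrite ler_wpM2r.
    clear -h1 h3; lra.
  apply: le_trans (prob_Gnr_ge (regular_graph_exists rltn ev) _ fail); first by rewrite lerD2l lerN2.
  move=> E regE [ok0 ok]; split; first exact: theta_half_lower.
  split; first exact/thetabar_half_le_thetabar/n1/compl_rel_irr.
  split; first exact/thetabar_le_thetabar_2/n1/compl_rel_irr.
  exact: theta_2_upper stt.
- exists (32 * discrepancy_const R)^-1; split; first by rewrite invr_gt0; apply: mulr_gt0; [rewrite ltr0n | exact: K0].
  move=> r r1 ro; have [N1 hN1] := ro 1 ltr01.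
  exists (maxn N1 256) => n; rewrite geq_max => /andP[nN1 n256] ev.
  have r0 := r_gt0 _ r1 n.
  have rn : (r n ^ 2 <= n)%N by apply: nat_le_sqrt_sqr; exact: hN1.
  have rltn : (r n < n)%N by nia.
  have n1 : (1 < n)%N by apply: leq_trans n256.
  have t0 : 16 ^+ 0 <= 16 * Num.sqrt ((r n)%:R : R).
    have s1 : 1 <= Num.sqrt ((r n)%:R : R) by rewrite -[leLHS]sqrtr1 ler_wsqrtr // r1.
    by rewrite expr0; lra.
  (* Level 0 suffices for the lower bound, and its failure probability is [exp(-n)]. *)
  have := level_fail n256 r0 rn t0; rewrite expr0 divr1 => fail.
  apply: (prob_Gnr_ge (regular_graph_exists rltn ev) _ fail) => E regE ok0.
  split; first exact: thetabar_half_lower.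
  split; first exact/thetabar_half_le_thetabar/n1/adj_irr.
  exact/thetabar_le_thetabar_2/n1/adj_irr.
Qed.
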